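(* Let $m\ge 2$, $q\ge 2$ be integers, let $\Omega$ be a nonempty closed subset of $\Sigma_m$, and let $$X_\Omega := \{x=(x_k)_{k=1}^\infty\in\Sigma_m:\ (x_{iq^\ell})_{\ell=0}^\infty\in\Omega\ \text{for all } i\ge 1 \text{ with } q\nmid i\}.$$ Let $\overline{t}=(t_u)_{u\in\mathrm{Pref}(\Omega)}$ be the unique vector in $[1,m^{1/(q-1)}]^{\mathrm{Pref}(\Omega)}$ with $t_u^q=\sum_{j:\ uj\in\mathrm{Pref}(\Omega)} t_{uj}$ for every $u\in\mathrm{Pref}(\Omega)$. Then (i) $\dim_H(X_\Omega) = (q-1)\log_m t_\varnothing$; (ii) the Minkowski dimension of $X_\Omega$ exists and $$\dim_M(X_\Omega) = (q-1)^2\sum_{k=1}^\infty \frac{\log_m|\mathrm{Pref}_k(\Omega)|}{q^{k+1}}.$$ Moreover, $\dim_H(X_\Omega)=\dim_M(X_\Omega)$ if and only if the tree of prefixes of $\Omega$ is spherically symmetric, i.e. for every $k\ge 1$ all $u\in\mathrm{Pref}_k(\Omega)$ have the same number of $j\in\{0,\dots,m-1\}$ with $uj\in\mathrm{Pref}_{k+1}(\Omega)$.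
   Context: $\Sigma_m=\{0,\dots,m-1\}^{\mathbb N}$ with metric $\varrho((x_k),(y_k)) = m^{-\min\{n:\ x_n\ne y_n\}+1}$; dimensions are taken with respect to this metric. For a word $u$, $[u]$ is the cylinder of sequences beginning with $u$. $\mathrm{Pref}_0(\Omega)=\{\varnothing\}$ (empty word), $\mathrm{Pref}_k(\Omega)=\{u\in\{0,\dots,m-1\}^k:\ \Omega\cap[u]\neq\emptyset\}$, $\mathrm{Pref}(\Omega)=\bigcup_{k\ge0}\mathrm{Pref}_k(\Omega)$. The tree of prefixes $\Gamma(\Omega)$ has vertex set $\mathrm{Pref}(\Omega)$ and a directed edge from $u$ to $uj$ whenever both are prefixes ($j\in\{0,\dots,m-1\}$); $uj$ denotes concatenation. $\log_m$ is logarithm base $m$. *)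

(* Defs.v *)
From Stdlib Require Import Reals Lra Lia List Classical ClassicalEpsilon.
Import ListNotations.
Open Scope R_scope.

(* Sequences x = (x_1, x_2, ...) are stored 0-indexed: x_n is [x (n-1)]. *)
Definition sequence := nat -> nat.
Definition sset := sequence -> Prop.

Definition inSigma (m : nat) (x : sequence) : Prop := forall k, (x k < m)%nat.

Definition dec (P : Prop) : bool :=
  if excluded_middle_informative P then true else false.

Definition first_diff (x y : sequence) : option nat :=
  match excluded_middle_informative
          (exists n, x n <> y n /\ forall k, (k < n)%nat -> x k = y k) with
  | left H => Some (proj1_sig (constructive_indefinite_description _ H))
  | right _ => None
  end.

(* rho(x,y) = m^{-min{n : x_n <> y_n}+1} (1-indexed n), i.e. m^{-p} with
   p the 0-indexed first difference; rho(x,x) = 0 *)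
Definition dist (m : nat) (x y : sequence) : R :=
  match first_diff x y with
  | None => 0
  | Some p => / (INR m ^ p)
  end.

(* classical supremum (0 if no least upper bound, e.g. empty set) *)
Definition Rsup (P : R -> Prop) : R :=
  match excluded_middle_informative (exists l, is_lub P l) with
  | left H => proj1_sig (constructive_indefinite_description _ H)
  | right _ => 0
  end.

Definition diam (m : nat) (A : sset) : R :=
  Rsup (fun r => exists x y, A x /\ A y /\ r = dist m x y).

(* d^s with the convention 0^s = 0 (used only for s > 0) *)
Definition powd (d s : R) : R := if Rle_dec d 0 then 0 else Rpower d s.

(* H^s(E) = 0 : for every delta > 0, H^s_delta(E) = inf of sums over countable
   delta-covers is 0 *)
Definition Hzero (m : nat) (s : R) (E : sset) : Prop :=
  forall delta eps, 0 < delta -> 0 < eps ->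
    exists U : nat -> sset,
      (forall n x, U n x -> inSigma m x) /\
      (forall n, diam m (U n) <= delta) /\
      (forall x, E x -> exists n, U n x) /\
      exists l, infinite_sum (fun n => powd (diam m (U n)) s) l /\ l < eps.

Definition is_glb (P : R -> Prop) (d : R) : Prop :=
  (forall s, P s -> d <= s) /\ (forall b, (forall s, P s -> b <= s) -> b <= d).

Definition is_dimH (m : nat) (E : sset) (d : R) : Prop :=
  is_glb (fun s => 0 < s /\ Hzero m s E) d.

Definition CoverN (m : nat) (r : R) (E : sset) (n : nat) : Prop :=
  exists U : nat -> sset,
    (forall i x, (i < n)%nat -> U i x -> inSigma m x) /\
    (forall i, (i < n)%nat -> diam m (U i) <= r) /\
    (forall x, E x -> exists i, (i < n)%nat /\ U i x).

Definition MinCover (m : nat) (r : R) (E : sset) (n : nat) : Prop :=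
  CoverN m r E n /\ forall n', CoverN m r E n' -> (n <= n')%nat.

Definition is_dimM (m : nat) (E : sset) (d : R) : Prop :=
  (forall r, 0 < r -> exists n, MinCover m r E n) /\
  forall eps, 0 < eps -> exists r0, 0 < r0 /\
    forall r n, 0 < r < r0 -> MinCover m r E n ->
      Rabs (ln (INR n) / (- ln r) - d) < eps.

Definition closed_in_Sigma (m : nat) (Omega : sset) : Prop :=
  forall x, inSigma m x ->
    (forall eps, 0 < eps -> exists y, Omega y /\ dist m x y < eps) -> Omega x.

Definition word := list nat.
Definition starts_with (x : sequence) (u : word) : Prop :=
  forall i, (i < length u)%nat -> x i = nth i u 0%nat.

Definition Pref_k (Omega : sset) (k : nat) (u : word) : Prop :=
  length u = k /\ exists x, Omega x /\ starts_with x u.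

Definition Pref (Omega : sset) (u : word) : Prop := Pref_k Omega (length u) u.

Fixpoint words (m k : nat) : list word :=
  match k with
  | O => [ [] ]
  | S k' => flat_map (fun u => map (fun j => u ++ [j]) (seq 0 m)) (words m k')
  end.

Definition card_Pref_k (m : nat) (Omega : sset) (k : nat) : nat :=
  length (filter (fun u => dec (Pref_k Omega k u)) (words m k)).

Definition nchild (m : nat) (Omega : sset) (u : word) : nat :=
  length (filter (fun j => dec (Pref Omega (u ++ [j]))) (seq 0 m)).

Definition spherically_symmetric (m : nat) (Omega : sset) : Prop :=
  forall k u v, (1 <= k)%nat -> Pref_k Omega k u -> Pref_k Omega k v ->
    nchild m Omega u = nchild m Omega v.

Definition child_sum (m : nat) (Omega : sset) (t : word -> R) (u : word) : R :=
  fold_right Rplus 0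
    (map (fun j => if dec (Pref Omega (u ++ [j])) then t (u ++ [j]) else 0)
         (seq 0 m)).

Definition tvec (m q : nat) (Omega : sset) (t : word -> R) : Prop :=
  forall u, Pref Omega u ->
    1 <= t u <= Rpower (INR m) (/ INR (q - 1)) /\
    t u ^ q = child_sum m Omega t u.

(* X_Omega, with x_n = x (n-1) *)
Definition X_Omega (m q : nat) (Omega : sset) : sset :=
  fun x => inSigma m x /\
    forall i, (1 <= i)%nat -> (i mod q <> 0)%nat ->
      Omega (fun l => x (i * q ^ l - 1)%nat).

Definition logm (m : nat) (x : R) : R := ln x / ln (INR m).

(* Main.v *)
(* A point of [X_Omega] is an arbitrary choice of an element of [Omega] along
   each chain [i, i q, i q^2, ...] with [q] not dividing [i], so counting and
   measuring cylinders of [X_Omega] factorises over chains.  Up to [n] the chain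
   structure is encoded by the [q]-adic valuation, and the averages
   [1/n sum_(p <= n) h (val p)] converge to [(1 - 1/q) sum_l h l / q^l].

   Minkowski dimension: the number of prefixes of length [n] is the product of
   the numbers [|Pref_k|] over the chains.

   Hausdorff dimension: let [mu] be the Markov measure on [Omega] with transition
   probabilities [t (uj) / t u ^ q], and put its product over the chains on
   [X_Omega].  For every point, the logarithms of the cylinder masses divided by
   the length, taken along the lengths [q^j], telescope around [(q-1) ln t_0] up
   to a bounded error; this gives covers of small cost.  For the lower bound,
   factorisation of the moments [sum_u mass(u)^(1+lam)] yields a Chernoff bound
   for the set of cylinders of too large mass, and a finite mass distribution
   argument (by compactness) concludes.

   Equality: [(q-1) ln t_0 = (q-1)^2 sum_k H_k / q^(k+1)] with [H_k] the entropy
   of [mu] on words of length [k], and [H_k <= ln |Pref_k|] with equality iff [mu]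
   is uniform on [Pref_k]; uniformity on all levels means spherical symmetry. *)

From Stdlib Require Import Reals Lra Lia List Arith Classical ClassicalEpsilon.
From Stdlib Require Import FunctionalExtensionality FinFun.
Require Import Defs.
Import ListNotations.
Open Scope R_scope.

(** No measure on the infinite space is constructed: the product measure enters only through the
    numbers [mass n x] and finite sums over words of one length. Compactness makes this possible,
    since it turns a countable cover into one by cylinders of bounded length, which can be compared
    at a common level. The two Hausdorff bounds use the masses in unequal strength. A cover may
    choose its scale point by point, so one good length per point suffices, and a deterministic
    telescoping provides it. The lower bound must exclude cylinders of too large mass at all lengths
    beyond some [N] at once, so their total mass has to be summable in the length; this is why
    exponential decay is needed. A step from [u] to [uj] has information
    [q * ln (t u) - ln (t (uj))]. The factor [q] matches the frequencies of the valuations [l],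
    proportional to [q ^ (-l)], hence the weighted entropies collapse to the value at the root. *)

Lemma fun_choice A B (R : A -> B -> Prop) :
  (forall x, exists y, R x y) -> exists f, forall x, R x (f x).
Proof.
  intros H; exists (fun x => proj1_sig (constructive_indefinite_description _ (H x))).
  intros x; apply proj2_sig.
Qed.

(** * Finite sums and products over lists *)

Definition lsum {A : Type} (l : list A) (f : A -> R) : R := fold_right Rplus 0 (map f l).
Definition lprod {A : Type} (l : list A) (f : A -> R) : R := fold_right Rmult 1 (map f l).
Definition ind (P : Prop) : R := if dec P then 1 else 0.

Lemma dec_true (P : Prop) : P -> dec P = true.
Proof. unfold dec; destruct (excluded_middle_informative P); tauto. Qed.

Lemma dec_false (P : Prop) : ~ P -> dec P = false.
Proof. unfold dec; destruct (excluded_middle_informative P); tauto. Qed.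

Lemma dec_iff (P : Prop) : dec P = true <-> P.
Proof. unfold dec; destruct (excluded_middle_informative P); split; intros; try tauto; discriminate. Qed.

Lemma ind_true (P : Prop) : P -> ind P = 1.
Proof. intros H; unfold ind; rewrite dec_true; auto. Qed.

Lemma ind_false (P : Prop) : ~ P -> ind P = 0.
Proof. intros H; unfold ind; rewrite dec_false; auto. Qed.

Lemma ind_bounds (P : Prop) : 0 <= ind P <= 1.
Proof. unfold ind; destruct (dec P); lra. Qed.

Lemma ind_iff (P Q : Prop) : (P <-> Q) -> ind P = ind Q.
Proof.
  intros H; destruct (classic P) as [p | p].
  - rewrite !ind_true; tauto.
  - rewrite !ind_false; tauto.
Qed.

Lemma lsum_nil A (f : A -> R) : lsum [] f = 0.
Proof. reflexivity. Qed.

Lemma lsum_cons A (a : A) l f : lsum (a :: l) f = f a + lsum l f.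
Proof. reflexivity. Qed.

Lemma lprod_nil A (f : A -> R) : lprod [] f = 1.
Proof. reflexivity. Qed.

Lemma lprod_cons A (a : A) l f : lprod (a :: l) f = f a * lprod l f.
Proof. reflexivity. Qed.

Lemma lsum_app A (l1 l2 : list A) f : lsum (l1 ++ l2) f = lsum l1 f + lsum l2 f.
Proof.
  induction l1 as [|a l IH]; simpl; [rewrite lsum_nil; lra|].
  rewrite !lsum_cons, IH; lra.
Qed.

Lemma lprod_app A (l1 l2 : list A) f : lprod (l1 ++ l2) f = lprod l1 f * lprod l2 f.
Proof.
  induction l1 as [|a l IH]; simpl; [rewrite lprod_nil; lra|].
  rewrite !lprod_cons, IH; lra.
Qed.

Lemma lsum_ext A (l : list A) f g : (forall a, In a l -> f a = g a) -> lsum l f = lsum l g.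
Proof.
  induction l as [|a l IH]; intros H; [reflexivity|].
  rewrite !lsum_cons, (H a), IH; auto; [intros; apply H; now right | now left].
Qed.

Lemma lprod_ext A (l : list A) f g : (forall a, In a l -> f a = g a) -> lprod l f = lprod l g.
Proof.
  induction l as [|a l IH]; intros H; [reflexivity|].
  rewrite !lprod_cons, (H a), IH; auto; [intros; apply H; now right | now left].
Qed.

Lemma lsum_le A (l : list A) f g : (forall a, In a l -> f a <= g a) -> lsum l f <= lsum l g.
Proof.
  induction l as [|a l IH]; intros H; [unfold lsum; simpl; lra|].
  rewrite !lsum_cons; apply Rplus_le_compat; [apply H; now left | apply IH; intros; apply H; now right].
Qed.

Lemma lsum_nonneg A (l : list A) f : (forall a, In a l -> 0 <= f a) -> 0 <= lsum l f.
Proof.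
  induction l as [|a l IH]; intros H; [rewrite lsum_nil; lra|].
  rewrite lsum_cons; assert (0 <= f a) by (apply H; now left).
  assert (0 <= lsum l f) by (apply IH; intros; apply H; now right); lra.
Qed.

Lemma lprod_nonneg A (l : list A) f : (forall a, In a l -> 0 <= f a) -> 0 <= lprod l f.
Proof.
  induction l as [|a l IH]; intros H; [rewrite lprod_nil; lra|].
  rewrite lprod_cons; apply Rmult_le_pos; [apply H; now left | apply IH; intros; apply H; now right].
Qed.

Lemma lprod_pos A (l : list A) f : (forall a, In a l -> 0 < f a) -> 0 < lprod l f.
Proof.
  induction l as [|a l IH]; intros H; [rewrite lprod_nil; lra|].
  rewrite lprod_cons; apply Rmult_lt_0_compat; [apply H; now left | apply IH; intros; apply H; now right].
Qed.

Lemma lprod_le A (l : list A) f g :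
  (forall a, In a l -> 0 <= f a <= g a) -> lprod l f <= lprod l g.
Proof.
  induction l as [|a l IH]; intros H; [unfold lprod; simpl; lra|].
  rewrite !lprod_cons; apply Rmult_le_compat.
  - apply H; now left.
  - apply lprod_nonneg; intros; apply H; now right.
  - apply H; now left.
  - apply IH; intros; apply H; now right.
Qed.

Lemma lprod_neq0 A (l : list A) f : lprod l f <> 0 -> forall a, In a l -> f a <> 0.
Proof.
  induction l as [|b l IH]; intros H a []; rewrite lprod_cons in H.
  - subst; intros E; apply H; rewrite E; lra.
  - apply IH; auto; intros E; apply H; rewrite E; lra.
Qed.

Lemma lprod_zero A (l : list A) f a : In a l -> f a = 0 -> lprod l f = 0.
Proof.
  intros Ha E; destruct (Req_dec (lprod l f) 0) as [|N]; auto.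
  now destruct (lprod_neq0 _ _ _ N a Ha).
Qed.

Lemma lsum_plus A (l : list A) f g : lsum l (fun a => f a + g a) = lsum l f + lsum l g.
Proof.
  induction l as [|a l IH]; [unfold lsum; simpl; lra|].
  rewrite !lsum_cons, IH; lra.
Qed.

Lemma lsum_scal A (l : list A) c f : lsum l (fun a => c * f a) = c * lsum l f.
Proof.
  induction l as [|a l IH]; [unfold lsum; simpl; lra|].
  rewrite !lsum_cons, IH; lra.
Qed.

Lemma lsum_minus A (l : list A) f g : lsum l (fun a => f a - g a) = lsum l f - lsum l g.
Proof.
  rewrite <- (Rmult_1_l (lsum l g)).
  induction l as [|a l IH]; [unfold lsum; simpl; lra|].
  rewrite !lsum_cons, IH; lra.
Qed.

Lemma lsum_const A (l : list A) c : lsum l (fun _ => c) = INR (length l) * c.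
Proof.
  induction l as [|a l IH]; [unfold lsum; simpl; lra|].
  rewrite lsum_cons, IH; change (length (a :: l)) with (S (length l)); rewrite S_INR; lra.
Qed.

Lemma lsum_zero A (l : list A) f : (forall a, In a l -> f a = 0) -> lsum l f = 0.
Proof. intros H; rewrite (lsum_ext _ _ _ (fun _ => 0) H), lsum_const; lra. Qed.

Lemma lsum_nonneg_eq0 A (l : list A) f :
  (forall a, In a l -> 0 <= f a) -> lsum l f = 0 -> forall a, In a l -> f a = 0.
Proof.
  induction l as [|b l IH]; intros H E a Ha; [destruct Ha|].
  rewrite lsum_cons in E.
  assert (0 <= f b) by (apply H; now left).
  assert (0 <= lsum l f) by (apply lsum_nonneg; intros; apply H; now right).
  destruct Ha as [<- | Ha]; [lra|]. apply IH; auto; [intros; apply H; now right | lra].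
Qed.

Lemma lsum_ge_term A (l : list A) f a :
  (forall b, In b l -> 0 <= f b) -> In a l -> f a <= lsum l f.
Proof.
  induction l as [|b l IH]; intros H Ha; [destruct Ha|].
  rewrite lsum_cons.
  assert (0 <= f b) by (apply H; now left).
  assert (0 <= lsum l f) by (apply lsum_nonneg; intros; apply H; now right).
  destruct Ha as [<- | Ha]; [lra|].
  enough (f a <= lsum l f) by lra; apply IH; auto; intros; apply H; now right.
Qed.

Lemma lsum_flat_map A B (l : list A) (h : A -> list B) f :
  lsum (flat_map h l) f = lsum l (fun a => lsum (h a) f).
Proof.
  induction l as [|a l IH]; simpl; [reflexivity|].
  rewrite lsum_app, lsum_cons, IH; reflexivity.
Qed.

Lemma lsum_map A B (l : list A) (h : A -> B) f : lsum (map h l) f = lsum l (fun a => f (h a)).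
Proof. unfold lsum; now rewrite map_map. Qed.

Lemma lsum_exchange A B (l : list A) (l' : list B) f :
  lsum l (fun a => lsum l' (fun b => f a b)) = lsum l' (fun b => lsum l (fun a => f a b)).
Proof.
  induction l as [|a l IH].
  - symmetry; apply lsum_zero; reflexivity.
  - rewrite lsum_cons, IH, <- lsum_plus; reflexivity.
Qed.

Lemma lsum_filter A (l : list A) (P : A -> Prop) f :
  lsum (filter (fun a => dec (P a)) l) f = lsum l (fun a => ind (P a) * f a).
Proof.
  induction l as [|a l IH]; simpl; [reflexivity|].
  rewrite lsum_cons, <- IH; unfold ind; destruct (dec (P a)); [rewrite lsum_cons|]; lra.
Qed.

Lemma length_filter_ind A (l : list A) (P : A -> Prop) :
  INR (length (filter (fun a => dec (P a)) l)) = lsum l (fun a => ind (P a)).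
Proof.
  rewrite <- (Rmult_1_r (INR _)), <- lsum_const, lsum_filter.
  apply lsum_ext; intros; lra.
Qed.

Lemma lsum_ind_unique A (l : list A) (P : A -> Prop) :
  NoDup l -> (forall a b, In a l -> In b l -> P a -> P b -> a = b) ->
  lsum l (fun a => ind (P a)) <= 1.
Proof.
  induction l as [|a l IH]; intros ND U; [rewrite lsum_nil; lra|].
  inversion ND; subst; rewrite lsum_cons.
  destruct (classic (P a)) as [p | p].
  - rewrite (lsum_zero _ l).
    + destruct (ind_bounds (P a)); lra.
    + intros b Hb; apply ind_false; intros pb.
      assert (a = b) by (apply U; auto; [now left | now right]); subst; tauto.
  - rewrite ind_false by auto. rewrite Rplus_0_l; apply IH; auto.
    intros; apply U; auto; now right.
Qed.

Lemma lprod_exp A (l : list A) f : lprod l (fun a => exp (f a)) = exp (lsum l f).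
Proof.
  induction l as [|a l IH]; [unfold lprod, lsum; simpl; now rewrite exp_0|].
  rewrite lprod_cons, lsum_cons, IH, exp_plus; reflexivity.
Qed.

Lemma lprod_one A (l : list A) f : (forall a, In a l -> f a = 1) -> lprod l f = 1.
Proof.
  induction l as [|a l IH]; intros H; [reflexivity|].
  rewrite lprod_cons, (H a), IH; [lra | intros; apply H; now right | now left].
Qed.

(** Appending a coordinate lengthens exactly one chain, so a product over chains changes in one
    factor only; inductions on the length use this form. *)
Lemma lprod_update (l : list nat) (i0 : nat) (c : R) (f g : nat -> R) :
  NoDup l -> In i0 l -> (forall i, i <> i0 -> g i = f i) -> g i0 = f i0 * c ->
  lprod l g = lprod l f * c.
Proof.
  intros ND; induction l as [|a l IH]; intros Hin Hoff Hat; [destruct Hin|].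
  inversion ND; subst; rewrite !lprod_cons.
  destruct (Nat.eq_dec a i0) as [-> | Ne].
  - rewrite Hat, (lprod_ext _ l g f); [lra|].
    intros i Hi; apply Hoff; intros ->; tauto.
  - destruct Hin as [|Hin]; [tauto|]. rewrite IH, Hoff by auto; lra.
Qed.

Lemma lsum_lprod_at B (A : list B) (l : list nat) (i0 : nat) (F : B -> R) (G : nat -> R) :
  NoDup l -> In i0 l ->
  lsum A (fun a => lprod l (fun i => if Nat.eq_dec i i0 then F a else G i)) =
  lprod l (fun i => if Nat.eq_dec i i0 then lsum A F else G i).
Proof.
  intros ND Hin.
  assert (E : forall c, lprod l (fun i => if Nat.eq_dec i i0 then c else G i) =
              lprod l (fun i => if Nat.eq_dec i i0 then 1 else G i) * c).
  { intros c; apply lprod_update with i0; auto.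
    - intros i Hi; destruct (Nat.eq_dec i i0); tauto.
    - destruct (Nat.eq_dec i0 i0); [lra | tauto]. }
  rewrite E, <- lsum_scal; apply lsum_ext; intros a _; apply E.
Qed.

Lemma lsum_seq_S (a n : nat) f : lsum (seq a (S n)) f = lsum (seq a n) f + f (a + n)%nat.
Proof. rewrite seq_S, lsum_app, lsum_cons, lsum_nil; lra. Qed.

Lemma lprod_seq_S (a n : nat) f : lprod (seq a (S n)) f = lprod (seq a n) f * f (a + n)%nat.
Proof. rewrite seq_S, lprod_app, lprod_cons, lprod_nil; lra. Qed.

Lemma lsum_seq_shift (a n : nat) f : lsum (seq (S a) n) f = lsum (seq a n) (fun k => f (S k)).
Proof. rewrite <- seq_shift, lsum_map; reflexivity. Qed.

Lemma sum_f_R0_lsum f n : sum_f_R0 f n = lsum (seq 0 (S n)) f.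
Proof.
  induction n as [|n IH]; [unfold lsum; simpl; lra|].
  rewrite lsum_seq_S, <- IH; reflexivity.
Qed.

Lemma lsum_nth A (L : list A) d g :
  lsum (seq 0 (length L)) (fun k => g (nth k L d)) = lsum L g.
Proof.
  induction L as [|a L IH]; [reflexivity|].
  change (length (a :: L)) with (S (length L)); rewrite <- cons_seq, !lsum_cons, lsum_seq_shift.
  rewrite <- IH; reflexivity.
Qed.

Lemma infinite_sum_finite f (K : nat) :
  (forall k, (K <= k)%nat -> f k = 0) -> infinite_sum f (lsum (seq 0 K) f).
Proof.
  intros H eps He; exists K; intros n Hn.
  rewrite sum_f_R0_lsum; unfold Rdist.
  assert (E : lsum (seq 0 (S n)) f = lsum (seq 0 K) f).
  { replace (S n) with (K + (S n - K))%nat by lia.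
    rewrite seq_app, lsum_app, (lsum_zero _ (seq (0 + K) _)); [lra|].
    intros a Ha; apply in_seq in Ha; apply H; lia. }
  rewrite E, Rminus_diag, Rabs_R0; auto.
Qed.

(** The bound does not depend on [K]: the depth that compactness yields for a cover comes without
    any control. *)
Lemma geometric_tail (eta : R) (K n0 : nat) : 0 < eta ->
  lsum (seq n0 K) (fun n => exp (- eta * INR n)) <= exp (- eta * INR n0) / (1 - exp (- eta)).
Proof.
  intros He.
  assert (H1 : exp (- eta) < 1) by (rewrite <- exp_0; apply exp_increasing; lra).
  revert n0; induction K as [|K IH]; intros n0.
  - simpl; rewrite lsum_nil; apply Rlt_le, Rdiv_lt_0_compat; [apply exp_pos | lra].
  - rewrite <- cons_seq, lsum_cons.
    apply Rle_trans with (exp (- eta * INR n0) + exp (- eta * INR (S n0)) / (1 - exp (- eta))).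
    + apply Rplus_le_compat_l, IH.
    + rewrite S_INR, Rmult_plus_distr_l, exp_plus, Rmult_1_r. apply Req_le; field; lra.
Qed.

Lemma exp_small (eta eps : R) : 0 < eta -> 0 < eps ->
  exists n0, forall n, (n0 <= n)%nat -> exp (- eta * INR n) < eps.
Proof.
  intros He Hp.
  destruct (INR_unbounded (/ (eta * eps))) as [n0 Hn0].
  exists n0; intros n Hn.
  assert (P : 0 < eta * eps) by now apply Rmult_lt_0_compat.
  assert (I0 : 0 < / (eta * eps)) by now apply Rinv_0_lt_compat.
  apply le_INR in Hn.
  assert (E1 : / eps < eta * INR n).
  { apply Rlt_le_trans with (eta * INR n0); [|apply Rmult_le_compat_l; lra].
    replace (/ eps) with (eta * / (eta * eps)) by (field; lra).
    apply Rmult_lt_compat_l; lra. }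
  assert (0 < / eps) by now apply Rinv_0_lt_compat.
  replace (- eta * INR n) with (- (eta * INR n)) by ring; rewrite exp_Ropp.
  rewrite <- (Rinv_inv eps); apply Rinv_lt_contravar.
  - apply Rmult_lt_0_compat; [auto | apply exp_pos].
  - apply Rlt_trans with (eta * INR n); auto.
    assert (1 + eta * INR n < exp (eta * INR n)) by (apply exp_ineq1; lra); lra.
Qed.

(** * The decomposition [p = base p * q ^ val p] *)

Section Arithmetic.
Context (q : nat) (hq : (2 <= q)%nat).

(** The fuel only serves structural recursion: a positive [p] is divided by [q >= 2] at each step,
    so [p] itself is enough fuel. *)
Fixpoint val_fuel (f p : nat) : nat :=
  match f with
  | O => O
  | S f' => if Nat.eq_dec (p mod q) 0 then S (val_fuel f' (p / q)) else O
  end.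

Definition val (p : nat) : nat := val_fuel p p.
Definition base (p : nat) : nat := (p / q ^ val p)%nat.

Lemma val_fuel_irrelevant f f' p :
  (1 <= p)%nat -> (p <= f)%nat -> (p <= f')%nat -> val_fuel f p = val_fuel f' p.
Proof.
  revert f' p; induction f as [|f IH]; intros f' p H1 Hf Hf'; [lia|].
  destruct f' as [|f']; [lia|]. simpl.
  destruct (Nat.eq_dec (p mod q) 0) as [E|]; auto. f_equal.
  assert (p = q * (p / q))%nat by (apply Nat.Div0.div_exact; auto).
  apply IH; nia.
Qed.

Lemma val_0 p : (p mod q <> 0)%nat -> val p = O.
Proof.
  intros H; unfold val; destruct p; auto; simpl val_fuel.
  destruct (Nat.eq_dec _ 0); tauto.
Qed.

Lemma val_mul p : (1 <= p)%nat -> val (p * q) = S (val p).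
Proof.
  intros H; unfold val.
  destruct (p * q)%nat as [|f] eqn:E; [nia|]. simpl val_fuel.
  rewrite <- E, Nat.Div0.mod_mul, Nat.div_mul by lia.
  destruct (Nat.eq_dec 0 0); [|tauto]. f_equal; apply val_fuel_irrelevant; nia.
Qed.

Lemma base_0 p : (p mod q <> 0)%nat -> base p = p.
Proof. intros H; unfold base; rewrite val_0 by auto; simpl; apply Nat.div_1_r. Qed.

Lemma base_mul p : (1 <= p)%nat -> base (p * q) = base p.
Proof.
  intros H; unfold base; rewrite val_mul by auto; simpl.
  rewrite (Nat.mul_comm q), Nat.Div0.div_mul_cancel_r; lia.
Qed.

Lemma qpow_pos l : (1 <= q ^ l)%nat.
Proof. enough (q ^ l <> 0)%nat by lia; apply Nat.pow_nonzero; lia. Qed.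

Lemma mul_ge1 i l : (1 <= i)%nat -> (1 <= i * q ^ l)%nat.
Proof. intros; pose proof (qpow_pos l); nia. Qed.

Lemma val_chain i l : (1 <= i)%nat -> (i mod q <> 0)%nat -> val (i * q ^ l) = l.
Proof.
  intros H1 H2; induction l as [|l IH]; simpl.
  - rewrite Nat.mul_1_r; now apply val_0.
  - replace (i * (q * q ^ l))%nat with (i * q ^ l * q)%nat by ring.
    rewrite val_mul, IH; auto; now apply mul_ge1.
Qed.

Lemma base_chain i l : (1 <= i)%nat -> (i mod q <> 0)%nat -> base (i * q ^ l) = i.
Proof.
  intros H1 H2; unfold base; rewrite val_chain by auto.
  apply Nat.div_mul, Nat.pow_nonzero; lia.
Qed.

Lemma base_val_spec p : (1 <= p)%nat ->
  p = (base p * q ^ val p)%nat /\ (1 <= base p)%nat /\ (base p mod q <> 0)%nat.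
Proof.
  induction p as [p IH] using lt_wf_ind; intros Hp.
  destruct (Nat.eq_dec (p mod q) 0) as [E | E].
  - assert (D : (p = q * (p / q))%nat) by (apply Nat.Div0.div_exact; auto).
    set (p' := (p / q)%nat) in *.
    destruct (IH p') as (H1 & H2 & H3); [nia | nia |].
    replace p with (p' * q)%nat by lia.
    rewrite base_mul, val_mul by nia; repeat split; auto. simpl; nia.
  - rewrite base_0, val_0 by auto; simpl; repeat split; auto; lia.
Qed.

(* The number of [l] with [i * q ^ l <= n], see [cnt_spec]. *)
Fixpoint cnt (i n : nat) : nat :=
  match n with
  | O => O
  | S n' => if Nat.eq_dec i (base n) then S (cnt i n') else cnt i n'
  end.

Lemma cnt_spec i n l : (1 <= i)%nat -> (i mod q <> 0)%nat ->
  (l < cnt i n <-> i * q ^ l <= n)%nat.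
Proof.
  intros H1 H2; revert l; induction n as [|n IH]; intros l.
  - simpl; pose proof (mul_ge1 i l H1); lia.
  - cbn [cnt]; destruct (Nat.eq_dec i (base (S n))) as [E | E].
    + destruct (base_val_spec (S n)) as (D & _ & _); [lia|]. rewrite <- E in D.
      set (v := val (S n)) in *.
      assert (M : forall a, (i * q ^ a <= i * q ^ v <-> a <= v)%nat).
      { intros a; split; intros Ha.
        - destruct (le_lt_dec a v) as [|Hv]; auto.
          assert (q ^ v < q ^ a)%nat by (apply Nat.pow_lt_mono_r; lia). nia.
        - assert (q ^ a <= q ^ v)%nat by (apply Nat.pow_le_mono_r; lia). nia. }
      (* A chain reaches its positions in increasing order, so exactly the indices below [v] have
         been counted before [S n = i * q ^ v]. *)
      assert (C : cnt i n = v).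
      { assert (~ (v < cnt i n)%nat) by (rewrite IH; lia).
        assert (forall a, (a < v)%nat -> (a < cnt i n)%nat).
        { intros a Ha; apply IH.
          assert (~ (i * q ^ v <= i * q ^ a)%nat); [|lia].
          assert (q ^ a < q ^ v)%nat by (apply Nat.pow_lt_mono_r; lia). nia. }
        destruct (Nat.eq_dec v 0); [lia|]. specialize (H0 (v - 1)%nat); lia. }
      rewrite C, D, M; lia.
    + rewrite IH; split; [lia|]. intros Hl.
      assert ((i * q ^ l)%nat <> S n); [|lia].
      intros Eq; apply E; rewrite <- Eq, base_chain; auto.
Qed.

(** When position [S n] is appended, its chain holds the letters of the indices below [val (S n)];
    the new letter continues a word of exactly that length. *)
Lemma cnt_base n : cnt (base (S n)) n = val (S n).
Proof.
  destruct (base_val_spec (S n)) as (D & H1 & H2); [lia|].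
  assert (A : (cnt (base (S n)) (S n) = S (cnt (base (S n)) n))%nat).
  { cbn [cnt]; destruct (Nat.eq_dec (base (S n)) (base (S n))); tauto. }
  set (b := base (S n)) in *. set (v := val (S n)) in *.
  assert (v < cnt b (S n))%nat by (apply cnt_spec; auto; lia).
  assert (~ (v < cnt b n)%nat) by (rewrite cnt_spec by auto; lia).
  lia.
Qed.

Lemma cnt_large i n : (1 <= i)%nat -> (i mod q <> 0)%nat -> (n < i)%nat -> cnt i n = O.
Proof.
  intros H1 H2 H3. enough (~ (0 < cnt i n)%nat) by lia.
  rewrite cnt_spec by auto; simpl; lia.
Qed.

Definition bases (N : nat) : list nat :=
  filter (fun i => if Nat.eq_dec (i mod q) 0 then false else true) (seq 1 N).

Lemma bases_NoDup N : NoDup (bases N).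
Proof. apply NoDup_filter, seq_NoDup. Qed.

Lemma in_bases i N : In i (bases N) <-> (1 <= i <= N)%nat /\ (i mod q <> 0)%nat.
Proof.
  clear hq; unfold bases; rewrite filter_In, in_seq.
  destruct (Nat.eq_dec (i mod q) 0); intuition (try lia; try discriminate).
Qed.

Lemma base_in_bases p N : (1 <= p <= N)%nat -> In (base p) (bases N).
Proof.
  intros H; apply in_bases; destruct (base_val_spec p) as (D & H1 & H2); [lia|].
  pose proof (qpow_pos (val p)); split; auto; nia.
Qed.

(** The exchange between chains and positions: [r i k] is the ratio of consecutive values of [G i],
    and position [p] accounts for the ratio at length [val p] of its chain. The list of bases may
    exceed [n], because chains that start later contribute [G i 0 = 1]; two lengths can thus be
    compared over one list. *)
Lemma lprod_bases (G r : nat -> nat -> R) (n N : nat) :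
  (n <= N)%nat -> (forall i, G i O = 1) -> (forall i k, G i (S k) = G i k * r i k) ->
  lprod (bases N) (fun i => G i (cnt i n)) = lprod (seq 1 n) (fun p => r (base p) (val p)).
Proof.
  intros Hn H0 HS; induction n as [|n IH].
  - apply lprod_one; intros; simpl; apply H0.
  - rewrite lprod_seq_S, <- IH by lia. simpl (1 + n)%nat.
    apply lprod_update with (base (S n)).
    + apply bases_NoDup.
    + apply base_in_bases; lia.
    + intros i Hi; cbn [cnt]; destruct (Nat.eq_dec i (base (S n))); tauto.
    + cbn [cnt]; destruct (Nat.eq_dec (base (S n)) (base (S n))); [|tauto].
      rewrite HS, cnt_base; reflexivity.
Qed.

(** The self-similarity of the positions under multiplication by [q]; it drives both the averages
    over [val] and the telescoping of the masses along powers of [q]. *)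
Lemma lsum_by_multiples (Q G : nat -> R) (c : R) (n : nat) :
  (forall p, (p mod q <> 0)%nat -> Q p = c) ->
  (forall p, (1 <= p)%nat -> Q (p * q)%nat = G p) ->
  lsum (seq 1 n) Q = c * (INR n - INR (n / q)) + lsum (seq 1 (n / q)) G.
Proof.
  intros H0 H1; induction n as [|n IH].
  - rewrite Nat.Div0.div_0_l; simpl; rewrite !lsum_nil; lra.
  - rewrite lsum_seq_S, IH; simpl (1 + n)%nat.
    destruct (Nat.eq_dec (S n mod q) 0) as [E | E].
    + assert (D : (S n = q * (S n / q))%nat) by (apply Nat.Div0.div_exact; auto).
      assert (F : (S n / q = S (n / q))%nat).
      { set (k := (S n / q)%nat) in *. destruct k as [|k]; [lia|]. f_equal.
        apply Nat.div_unique with (q - 1)%nat; nia. }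
      rewrite F in *. rewrite lsum_seq_S. simpl (1 + n / q)%nat.
      rewrite D, Nat.mul_comm, H1 by lia. rewrite <- (Nat.mul_comm q), <- D, !S_INR; ring.
    + assert (F : (S n / q = n / q)%nat).
      { apply Nat.div_unique with (S n mod q - 1)%nat.
        - assert (S n mod q < q)%nat by (apply Nat.mod_upper_bound; lia); lia.
        - pose proof (Nat.div_mod_eq (S n) q); lia. }
      rewrite F, H0, S_INR by auto; ring.
Qed.

Lemma INR_q_ge2 : 2 <= INR q.
Proof. apply (le_INR 2); auto. Qed.

Lemma INR_div_bounds n : INR n / INR q - 1 <= INR (n / q) <= INR n / INR q.
Proof.
  pose proof INR_q_ge2 as Hq.
  pose proof (Nat.div_mod_eq n q) as D.
  assert (L : (n mod q < q)%nat) by (apply Nat.mod_upper_bound; lia).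
  apply (f_equal INR) in D; rewrite plus_INR, mult_INR in D.
  apply lt_INR in L; pose proof (pos_INR (n mod q)).
  assert (E : INR n / INR q = INR (n / q) + INR (n mod q) / INR q) by (rewrite D; field; lra).
  assert (0 <= INR (n mod q) / INR q) by (apply Rmult_le_pos; [lra | apply Rlt_le, Rinv_0_lt_compat; lra]).
  assert (INR (n mod q) / INR q <= 1).
  { apply Rmult_le_reg_r with (INR q); [lra|]. unfold Rdiv; rewrite Rmult_assoc, Rinv_l by lra; lra. }
  lra.
Qed.

Lemma lsum_val_rec (h : nat -> R) n :
  lsum (seq 1 n) (fun p => h (val p)) =
  h O * (INR n - INR (n / q)) + lsum (seq 1 (n / q)) (fun p => h (S (val p))).
Proof.
  apply lsum_by_multiples.
  - intros p Hp; now rewrite val_0.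
  - intros p Hp; now rewrite val_mul.
Qed.

(** The numbers [(1 - 1/q) / q ^ l] are the limiting frequencies of the valuations [l]; the first
    [L] of them sum to [1 - 1/q^L]. *)
Lemma geometric_bound L :
  0 <= (1 - / INR q) * lsum (seq 0 L) (fun l => / INR q ^ l) <= 1.
Proof.
  pose proof INR_q_ge2 as Hq.
  assert (E : (1 - / INR q) * lsum (seq 0 L) (fun l => / INR q ^ l) = 1 - / INR q ^ L).
  { induction L as [|L IH]; [simpl; rewrite lsum_nil; lra|].
    rewrite lsum_seq_S, Rmult_plus_distr_l, IH; simpl (0 + L)%nat; simpl.
    field; split; [apply pow_nonzero|]; lra. }
  rewrite E; assert (0 < / INR q ^ L) by (apply Rinv_0_lt_compat, pow_lt; lra).
  assert (/ INR q ^ L <= 1); [|lra].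
  rewrite <- Rinv_1; apply Rinv_le_contravar; [lra|]. apply pow_R1_Rle; lra.
Qed.

Lemma abs_lsum_bound (B : R) (h : nat -> R) (l : list nat) w :
  (forall i, Rabs (h i) <= B) -> (forall i, 0 <= w i) ->
  Rabs (lsum l (fun i => h i * w i)) <= B * lsum l w.
Proof.
  intros HB Hw; induction l as [|a l IH].
  - rewrite !lsum_nil, Rabs_R0; lra.
  - rewrite !lsum_cons. eapply Rle_trans; [apply Rabs_triang|].
    rewrite Rabs_mult, (Rabs_pos_eq (w a)) by auto.
    specialize (HB a); specialize (Hw a). nra.
Qed.

(** Each use of [lsum_val_rec] splits off valuation 0, replaces [h] by its shift and [n] by [n / q],
    and costs at most [2 * B] through the rounding in [n / q]. After [L] rounds the rest is
    estimated trivially by [B * n / q ^ L]. *)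
Lemma lsum_val_truncated (B : R) (L : nat) : forall (h : nat -> R) (n : nat),
  (forall l, Rabs (h l) <= B) ->
  Rabs (lsum (seq 1 n) (fun p => h (val p))
        - INR n * ((1 - / INR q) * lsum (seq 0 L) (fun l => h l / INR q ^ l)))
  <= 2 * B * INR L + B * INR n / INR q ^ L.
Proof.
  pose proof INR_q_ge2 as Hq.
  induction L as [|L IH]; intros h n HB.
  - simpl (seq 0 0); rewrite lsum_nil, (Rmult_0_r (1 - / INR q)), (Rmult_0_r (INR n)), Rminus_0_r. simpl (INR q ^ 0).
    replace (2 * B * INR 0 + B * INR n / 1) with (B * lsum (seq 1 n) (fun _ => 1)).
    2:{ rewrite lsum_const, length_seq; simpl; field. }
    rewrite (lsum_ext _ _ _ (fun p => h (val p) * 1)) by (intros; ring).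
    apply abs_lsum_bound with (h := fun p => h (val p)); auto; intros; lra.
  - rewrite lsum_val_rec, <- cons_seq, lsum_cons, (lsum_seq_shift 0 L).
    set (n' := (n / q)%nat).
    specialize (IH (fun l => h (S l)) n' (fun l => HB (S l))); cbn beta in IH.
    set (A := lsum (seq 1 n') _) in *.
    set (Sg := lsum (seq 0 L) (fun l => h (S l) / INR q ^ l)) in *.
    assert (E : lsum (seq 0 L) (fun k => h (S k) / INR q ^ S k) = Sg / INR q).
    { unfold Sg, Rdiv; rewrite Rmult_comm, <- lsum_scal; apply lsum_ext; intros; simpl.
      field; split; [apply pow_nonzero|]; lra. }
    rewrite E; simpl (INR q ^ 0).
    assert (Hn : INR n / INR q - 1 <= INR n' <= INR n / INR q) by apply INR_div_bounds.
    assert (HS : Rabs ((1 - / INR q) * Sg) <= B).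
    { assert (I0 : 0 < 1 - / INR q).
      { assert (/ INR q <= / 2) by (apply Rinv_le_contravar; lra). lra. }
      rewrite Rabs_mult, Rabs_pos_eq by lra.
      assert (HH : Rabs Sg <= B * lsum (seq 0 L) (fun l => / INR q ^ l)).
      { unfold Sg, Rdiv; apply abs_lsum_bound with (h := fun l => h (S l)); auto.
        intros; apply Rlt_le, Rinv_0_lt_compat, pow_lt; lra. }
      pose proof (geometric_bound L). assert (0 <= B) by (specialize (HB O); pose proof (Rabs_pos (h O)); lra).
      apply Rle_trans with ((1 - / INR q) * (B * lsum (seq 0 L) (fun l => / INR q ^ l))).
      - apply Rmult_le_compat_l; lra.
      - nra. }
    set (T := (1 - / INR q) * Sg) in *. set (d := INR n / INR q - INR n').
    replace (h O * (INR n - INR n') + A - INR n * ((1 - / INR q) * (h O / 1 + Sg / INR q)))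
      with ((A - INR n' * T) + (h O * d - d * T)) by (unfold T, d; field; lra).
    eapply Rle_trans; [apply Rabs_triang|].
    (* [d] is the rounding error of the integer division and lies in [0, 1]. *)
    assert (P1 : Rabs (h O * d - d * T) <= 2 * B).
    { replace (h O * d - d * T) with (d * (h O - T)) by ring.
      rewrite Rabs_mult. rewrite Rabs_pos_eq by (unfold d; lra).
      assert (Rabs (h O - T) <= 2 * B).
      { unfold Rminus; eapply Rle_trans; [apply Rabs_triang|]. rewrite Rabs_Ropp. specialize (HB O); lra. }
      pose proof (Rabs_pos (h O - T)). assert (0 <= d <= 1) by (unfold d; lra). nra. }
    assert (P2 : B * INR n' / INR q ^ L <= B * INR n / INR q ^ S L).
    { simpl. replace (B * INR n / (INR q * INR q ^ L)) with (B * (INR n / INR q) / INR q ^ L)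
        by (field; split; [apply pow_nonzero|]; lra).
      assert (0 <= B) by (specialize (HB O); pose proof (Rabs_pos (h O)); lra).
      apply Rmult_le_compat_r; [apply Rlt_le, Rinv_0_lt_compat, pow_lt; lra|].
      apply Rmult_le_compat_l; lra. }
    rewrite S_INR. lra.
Qed.

Lemma inv_pow_small (B eps : R) : 0 < eps -> exists L0, forall L, (L0 <= L)%nat -> B / INR q ^ L < eps.
Proof.
  intros He. pose proof INR_q_ge2 as Hq.
  destruct (exp_small (ln (INR q)) (eps / (Rabs B + 1))) as [L0 H].
  - rewrite <- ln_1; apply ln_increasing; lra.
  - apply Rdiv_lt_0_compat; auto. pose proof (Rabs_pos B); lra.
  - exists L0; intros L HL; specialize (H L HL). pose proof (Rabs_pos B) as HB.
    assert (E : exp (- ln (INR q) * INR L) = / INR q ^ L).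
    { replace (- ln (INR q) * INR L) with (- (INR L * ln (INR q))) by ring.
      rewrite exp_Ropp; f_equal. change (Rpower (INR q) (INR L) = INR q ^ L).
      apply Rpower_pow; lra. }
    rewrite E in H. assert (P : 0 < / INR q ^ L) by (apply Rinv_0_lt_compat, pow_lt; lra).
    apply Rle_lt_trans with ((Rabs B + 1) * / INR q ^ L).
    + apply Rmult_le_compat_r; [lra|]. pose proof (Rle_abs B); lra.
    + apply (Rmult_lt_compat_l (Rabs B + 1)) in H; [|lra].
      replace ((Rabs B + 1) * (eps / (Rabs B + 1))) with eps in H by (field; lra). auto.
Qed.

Lemma lsum_val_asymptotics (B I0 : R) (h : nat -> R) :
  (forall l, Rabs (h l) <= B) ->
  Un_cv (fun L => (1 - / INR q) * lsum (seq 0 L) (fun l => h l / INR q ^ l)) I0 ->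
  forall eps, 0 < eps -> exists n0, forall n, (n0 <= n)%nat ->
    Rabs (lsum (seq 1 n) (fun p => h (val p)) - INR n * I0) <= eps * INR n.
Proof.
  intros HB Hcv eps He.
  destruct (Hcv (eps / 3)) as [L1 H1]; [lra|].
  destruct (inv_pow_small B (eps / 3)) as [L2 H2]; [lra|].
  set (L := Nat.max L1 L2).
  specialize (H1 L (Nat.le_max_l _ _)); specialize (H2 L (Nat.le_max_r _ _)).
  unfold Rdist in H1. set (Sg := (1 - / INR q) * _) in H1.
  destruct (INR_unbounded (2 * B * INR L / (eps / 3))) as [n0 Hn0].
  exists n0; intros n Hn; apply le_INR in Hn.
  pose proof (lsum_val_truncated B L h n HB) as T. fold Sg in T.
  set (A := lsum (seq 1 n) (fun p => h (val p))) in *.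
  replace (A - INR n * I0) with ((A - INR n * Sg) + INR n * (Sg - I0)) by ring.
  eapply Rle_trans; [apply Rabs_triang|].
  rewrite Rabs_mult, (Rabs_pos_eq (INR n)) by apply pos_INR.
  assert (E1 : 2 * B * INR L <= eps / 3 * INR n).
  { apply (Rmult_lt_compat_l (eps / 3)) in Hn0; [|lra].
    replace (eps / 3 * (2 * B * INR L / (eps / 3))) with (2 * B * INR L) in Hn0 by (field; lra).
    assert (eps / 3 * INR n0 <= eps / 3 * INR n) by (apply Rmult_le_compat_l; lra). lra. }
  assert (E2 : B * INR n / INR q ^ L <= eps / 3 * INR n).
  { replace (B * INR n / INR q ^ L) with (B / INR q ^ L * INR n) by (unfold Rdiv; ring).
    apply Rmult_le_compat_r; [apply pos_INR | lra]. }
  assert (E3 : INR n * Rabs (Sg - I0) <= INR n * (eps / 3)).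
  { apply Rmult_le_compat_l; [apply pos_INR | lra]. }
  lra.
Qed.

(** By the recursion the sum at [n] is [n / q] plus the sum at [n / q], hence at most
    [2 * (n / q) <= n]. This keeps the quadratic terms of the moment estimate linear in the
    length. *)
Lemma lsum_val_le n : lsum (seq 1 n) (fun p => INR (val p)) <= INR n.
Proof.
  induction n as [n IH] using lt_wf_ind.
  destruct n as [|n]; [simpl; rewrite lsum_nil; lra|].
  rewrite (lsum_val_rec INR), (lsum_ext _ _ _ (fun p => INR (val p) + 1)), lsum_plus, lsum_const, length_seq
    by (intros; apply S_INR).
  specialize (IH (S n / q)%nat). pose proof (INR_div_bounds (S n)) as Hd. pose proof INR_q_ge2.
  assert (S n / q < S n)%nat by (apply Nat.div_lt; lia).
  assert (INR (S n) / INR q <= INR (S n) / 2).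
  { apply Rmult_le_compat_l; [apply pos_INR | apply Rinv_le_contravar; lra]. }
  change (INR 0) with 0. specialize (IH H0). lra.
Qed.

End Arithmetic.

(** * Words, cylinders and the metric *)

(** Padding with zeros lets functions of sequences be evaluated on words; the padding is invisible
    to whatever depends on the first [length u] coordinates only. *)
Definition toseq (u : word) : sequence := fun i => nth i u 0%nat.
Definition agree (k : nat) (x y : sequence) : Prop := forall i, (i < k)%nat -> x i = y i.

Lemma agree_le k k' x y : (k' <= k)%nat -> agree k x y -> agree k' x y.
Proof. intros H A i Hi; apply A; lia. Qed.

Lemma agree_sym k x y : agree k x y -> agree k y x.
Proof. intros A i Hi; symmetry; auto. Qed.

Lemma agree_trans k x y z : agree k x y -> agree k y z -> agree k x z.
Proof. intros A B i Hi; rewrite A, B; auto. Qed.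

Lemma starts_with_agree x u : starts_with x u <-> agree (length u) x (toseq u).
Proof. reflexivity. Qed.

Lemma toseq_app u a : agree (length u) (toseq (u ++ [a])) (toseq u).
Proof. intros i Hi; unfold toseq; now rewrite app_nth1. Qed.

Lemma toseq_app_last u a : toseq (u ++ [a]) (length u) = a.
Proof. unfold toseq; now rewrite app_nth2, Nat.sub_diag by lia. Qed.

Lemma toseq_prefix n x : agree n (toseq (map x (seq 0 n))) x.
Proof.
  intros i Hi; unfold toseq. rewrite nth_indep with (d' := x 0%nat) by now rewrite length_map, length_seq.
  rewrite map_nth, seq_nth; auto.
Qed.

Lemma starts_with_prefix n x : starts_with x (map x (seq 0 n)).
Proof.
  rewrite starts_with_agree, length_map, length_seq; apply agree_sym, toseq_prefix.
Qed.

Lemma list_eq_toseq (u v : word) :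
  length u = length v -> agree (length u) (toseq u) (toseq v) -> u = v.
Proof. intros E A; apply nth_ext with 0%nat 0%nat; auto. Qed.

Lemma in_words m n u :
  In u (words m n) <-> length u = n /\ forall i, (i < n)%nat -> (toseq u i < m)%nat.
Proof.
  revert u; induction n as [|n IH]; intros u.
  - simpl; split.
    + intros [<- | []]; split; [reflexivity | intros; lia].
    + intros [E _]; left; symmetry; now apply length_zero_iff_nil.
  - cbn [words]; rewrite in_flat_map; split.
    + intros (v & Hv & Hu); apply in_map_iff in Hu as (a & <- & Ha).
      apply IH in Hv as [L B]; apply in_seq in Ha.
      rewrite length_app; simpl; split; [lia|].
      intros i Hi; destruct (Nat.eq_dec i n) as [-> | Ne].
      * rewrite <- L, toseq_app_last; lia.
      * rewrite toseq_app by lia; apply B; lia.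
    + intros [L B].
      destruct (exists_last (l := u)) as (v & a & ->); [intros ->; discriminate|].
      rewrite length_app in L; simpl in L; exists v.
      assert (Lv : length v = n) by lia. split.
      * apply IH; split; auto. intros i Hi; rewrite <- (toseq_app v a) by lia; apply B; lia.
      * apply in_map_iff; exists a; split; auto; apply in_seq.
        specialize (B n); rewrite <- Lv, toseq_app_last in B; lia.
Qed.

Lemma words_length m n u : In u (words m n) -> length u = n.
Proof. intros H; now apply in_words in H. Qed.

Lemma prefix_in_words m n x : inSigma m x -> In (map x (seq 0 n)) (words m n).
Proof.
  intros H; apply in_words; rewrite length_map, length_seq; split; auto.
  intros i Hi; rewrite toseq_prefix; auto.
Qed.

Lemma words_NoDup m n : NoDup (words m n).
Proof.
  induction n as [|n IH]; [repeat constructor; auto|].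
  cbn [words].
  assert (NA : forall l u, NoDup l -> NoDup (map (fun j : nat => u ++ [j]) l)).
  { intros l u Hl; apply Injective_map_NoDup; auto.
    intros a b E; apply app_inj_tail in E; tauto. }
  induction (words m n) as [|u l IHl]; [constructor|].
  inversion IH; subst; simpl; apply NoDup_app; auto.
  - apply NA, seq_NoDup.
  - intros w Hw Hw'; apply in_map_iff in Hw as (a & <- & _).
    apply in_flat_map in Hw' as (v & Hv & Hw'); apply in_map_iff in Hw' as (b & E & _).
    apply app_inj_tail in E as [-> _]; tauto.
Qed.

Lemma lsum_words_S m n f :
  lsum (words m (S n)) f = lsum (words m n) (fun u => lsum (seq 0 m) (fun a => f (u ++ [a]))).
Proof.
  cbn [words]; rewrite lsum_flat_map; apply lsum_ext; intros; apply lsum_map.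
Qed.

(** * Metric, diameters and compactness *)

Section Metric.
Context (m : nat) (hm : (2 <= m)%nat).

Lemma INR_m_ge2 : 2 <= INR m.
Proof. apply (le_INR 2); auto. Qed.

Lemma ln_m_pos : 0 < ln (INR m).
Proof. pose proof INR_m_ge2; rewrite <- ln_1; apply ln_increasing; lra. Qed.

Lemma m_pow_exp p : / INR m ^ p = exp (- INR p * ln (INR m)).
Proof.
  pose proof INR_m_ge2. rewrite <- Ropp_mult_distr_l, exp_Ropp; f_equal.
  change (INR m ^ p = Rpower (INR m) (INR p)). rewrite Rpower_pow; lra.
Qed.

Lemma inv_pow_le_iff p p' : / INR m ^ p <= / INR m ^ p' <-> (p' <= p)%nat.
Proof.
  pose proof ln_m_pos as L. rewrite !m_pow_exp; split; intros H.
  - destruct (le_lt_dec p' p) as [|Hl]; auto; exfalso.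
    apply lt_INR in Hl. apply Rle_not_lt in H; apply H, exp_increasing.
    apply Rmult_lt_compat_r; lra.
  - apply le_INR in H. destruct (Req_dec (INR p) (INR p')) as [-> | N]; [lra|].
    apply Rlt_le, exp_increasing, Rmult_lt_compat_r; lra.
Qed.

Lemma inv_pow_pos p : 0 < / INR m ^ p.
Proof. rewrite m_pow_exp; apply exp_pos. Qed.

Lemma dist_le_iff x y p : dist m x y <= / INR m ^ p <-> agree p x y.
Proof.
  unfold dist, first_diff.
  destruct (excluded_middle_informative _) as [H | H].
  - destruct (constructive_indefinite_description _ H) as (n & Hn & Hk); simpl.
    rewrite inv_pow_le_iff; split.
    + intros Hp i Hi; apply Hk; lia.
    + intros A; destruct (le_lt_dec p n) as [|Hl]; auto; exfalso; apply Hn, A; auto.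
  - split; [intros _ | intros _; apply Rlt_le, inv_pow_pos].
    intros i _; apply NNPP; intros N; apply H.
    destruct (dec_inh_nat_subset_has_unique_least_element (fun n => x n <> y n)) as (n & [Hn Hm] & _).
    + intros n; apply classic.
    + now exists i.
    + exists n; split; auto. intros k Hk; apply NNPP; intros Nk; apply Hm in Nk; lia.
Qed.

Lemma dist_le_1 x y : dist m x y <= 1.
Proof.
  rewrite <- Rinv_1. change 1 with (INR m ^ 0); apply dist_le_iff; intros i Hi; lia.
Qed.

Lemma dist_cases x y : dist m x y = 0 \/ exists p, dist m x y = / INR m ^ p.
Proof. unfold dist; destruct (first_diff x y) as [p|]; [right; now exists p | now left]. Qed.

(** The assumption [0 <= r] covers the default value 0 of [Rsup], which is the diameter of the empty
    set. *)
Lemma diam_le (U : sset) r :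
  0 <= r -> (forall x y, U x -> U y -> dist m x y <= r) -> diam m U <= r.
Proof.
  intros Hr H; unfold diam, Rsup; destruct (excluded_middle_informative _) as [E | _]; auto.
  destruct (constructive_indefinite_description _ E) as (l & Hu & Hl); simpl.
  apply Hl; intros d (x & y & Hx & Hy & ->); auto.
Qed.

Lemma dist_le_diam (U : sset) x y : U x -> U y -> dist m x y <= diam m U.
Proof.
  intros Hx Hy; unfold diam, Rsup; destruct (excluded_middle_informative _) as [E | E].
  - destruct (constructive_indefinite_description _ E) as (l & Hl & Hu); simpl.
    apply Hl; exists x, y; auto.
  - exfalso; apply E.
    destruct (completeness (fun r => exists x y, U x /\ U y /\ r = dist m x y)) as [l Hl].
    + exists 1; intros d (x' & y' & _ & _ & ->); apply dist_le_1.
    + exists (dist m x y), x, y; auto.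
    + now exists l.
Qed.

Lemma diam_cylinder (U : sset) p :
  (forall x y, U x -> U y -> agree p x y) -> diam m U <= / INR m ^ p.
Proof.
  intros H; apply diam_le; [apply Rlt_le, inv_pow_pos|].
  intros; apply dist_le_iff; auto.
Qed.

Lemma exists_pow_small r : 0 < r -> exists p, / INR m ^ p <= r.
Proof.
  intros Hr; destruct (exp_small (ln (INR m)) r) as [n0 H]; auto using ln_m_pos.
  exists n0; rewrite m_pow_exp. apply Rlt_le.
  replace (- INR n0 * ln (INR m)) with (- ln (INR m) * INR n0) by ring; auto.
Qed.

Lemma scale_exists r : 0 < r < 1 ->
  exists n, (1 <= n)%nat /\ / INR m ^ n <= r < / INR m ^ (n - 1).
Proof.
  intros [Hr H1]; destruct (exists_pow_small r Hr) as [p Hp].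
  destruct (dec_inh_nat_subset_has_unique_least_element (fun n => / INR m ^ n <= r)) as (n & [Hn Hm] & _).
  - intros; apply classic.
  - now exists p.
  - assert (n <> O) by (intros ->; simpl in Hn; rewrite Rinv_1 in Hn; lra).
    exists n; repeat split; auto; [lia|].
    apply Rnot_le_lt; intros N; apply Hm in N; lia.
Qed.

(** Closedness phrased through prefixes alone, a form that passes from [Omega] to [X_Omega] chain by
    chain. *)
Definition seq_closed (X : sset) : Prop :=
  forall x, (forall k, exists y, X y /\ agree k x y) -> X x.

Lemma closed_in_Sigma_seq_closed (Om : sset) :
  (forall x, Om x -> inSigma m x) -> closed_in_Sigma m Om -> seq_closed Om.
Proof.
  intros HS HC x Hx; apply HC.
  - intros k; destruct (Hx (S k)) as (y & Hy & A). rewrite A by lia; now apply HS.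
  - intros eps He; destruct (exists_pow_small (eps / 2)) as [p Hp]; [lra|].
    destruct (Hx p) as (y & Hy & A); exists y; split; auto.
    apply dist_le_iff in A; lra.
Qed.

(* Koenig's lemma: a finite alphabet lets us follow a branch none of whose
   cylinders is finitely covered. *)
Lemma compactness (X : sset) (C : nat -> sset) :
  (forall x, X x -> inSigma m x) -> seq_closed X ->
  (forall n x, C n x -> exists k, forall y, agree k x y -> C n y) ->
  (forall x, X x -> exists n, C n x) ->
  exists M, forall x, X x -> exists n, (n <= M)%nat /\ C n x.
Proof.
  intros HS HC Hopen Hcov; apply NNPP; intros Hno.
  (* [P u]: no finite part of the family covers the points of [X] in the cylinder of [u]. *)
  set (P := fun u : word => forall M, exists x, X x /\ starts_with x u /\
                            forall n, (n <= M)%nat -> ~ C n x).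
  assert (P0 : P []).
  { intros M; apply NNPP; intros N; apply Hno; exists M; intros x Hx.
    apply NNPP; intros N'; apply N; exists x; repeat split; auto.
    - intros i Hi; simpl in Hi; lia.
    - intros n Hn Cn; apply N'; exists n; auto. }
  (* If every child cylinder were finitely covered, the largest of the finitely many bounds would
     serve [u]. The implication stands inside the existential so that choice gives a total map [f]
     on words. *)
  assert (PS : forall u, exists a, P u -> P (u ++ [a])).
  { intros u; apply NNPP; intros N.
    assert (Pu : P u) by (apply NNPP; intros Nu; apply N; exists O; tauto).
    assert (Ha : forall a, exists M, forall x, X x -> starts_with x (u ++ [a]) ->
                   exists n, (n <= M)%nat /\ C n x).
    { intros a; apply NNPP; intros Na; apply N; exists a; intros _ M.
      apply NNPP; intros N1; apply Na; exists M; intros x Hx Hs.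
      apply NNPP; intros N2; apply N1; exists x; repeat split; auto.
      intros n Hn Cn; apply N2; exists n; auto. }
    apply fun_choice in Ha as [Mf HM].
    assert (Hb : exists B, forall a, (a < m)%nat -> (Mf a <= B)%nat).
    { exists (list_max (map Mf (seq 0 m))); intros a Ha.
      pose proof (proj1 (list_max_le (map Mf (seq 0 m)) _) (le_n _)) as F.
      rewrite Forall_forall in F; apply F, in_map, in_seq; lia. }
    destruct Hb as [B HB]; destruct (Pu B) as (x & Hx & Hs & Hn).
    assert (Lx : (x (length u) < m)%nat) by now apply HS.
    destruct (HM (x (length u)) x Hx) as (n & Hn' & Cn).
    - intros i Hi; rewrite length_app in Hi; simpl in Hi.
      change (x i = toseq (u ++ [x (length u)]) i).
      destruct (Nat.eq_dec i (length u)) as [-> | Ne]; [now rewrite toseq_app_last|].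
      rewrite toseq_app by lia; apply Hs; lia.
    - apply (Hn n); auto. specialize (HB _ Lx); lia. }
  apply fun_choice in PS as [f Hf].
  pose (path := fix path n := match n with O => [] | S n' => path n' ++ [f (path n')] end).
  assert (Pp : forall n, P (path n)) by (induction n; simpl; auto).
  pose (x := fun k => f (path k)).
  assert (Ep : forall n, path n = map x (seq 0 n)).
  { induction n as [|n IH]; auto. rewrite seq_S, map_app, <- IH; reflexivity. }
  assert (HA : forall k y, starts_with y (path k) -> agree k x y).
  { intros k y Hy; rewrite starts_with_agree, Ep, length_map, length_seq in Hy.
    apply agree_sym; eapply agree_trans; [apply Hy | apply toseq_prefix]. }
  assert (Xx : X x).
  { apply HC; intros k; destruct (Pp k O) as (y & Hy & Hs & _); exists y; auto. }
  destruct (Hcov x Xx) as [n Cn]; destruct (Hopen n x Cn) as [k Hk].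
  (* The single set [C n] contains the whole cylinder of [path k], against [P (path k)] for the
     bound [n]. *)
  destruct (Pp k n) as (y & Hy & Hs & Hn); apply (Hn n); auto.
Qed.

End Metric.

(** * Chains *)

Section Chains.
Context (m q : nat) (hq : (2 <= q)%nat).

Definition chain (i k : nat) (x : sequence) : word :=
  map (fun l => x (i * q ^ l - 1)%nat) (seq 0 k).

Lemma chain_S i k x : chain i (S k) x = chain i k x ++ [x (i * q ^ k - 1)%nat].
Proof. unfold chain; rewrite seq_S, map_app; reflexivity. Qed.

Lemma chain_length i k x : length (chain i k x) = k.
Proof. unfold chain; now rewrite length_map, length_seq. Qed.

Lemma chain_agree i n x y : (1 <= i)%nat -> (i mod q <> 0)%nat -> agree n x y ->
  chain i (cnt q i n) x = chain i (cnt q i n) y.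
Proof.
  intros H1 H2 A; apply map_ext_in; intros l Hl; apply in_seq in Hl; apply A.
  assert (i * q ^ l <= n)%nat by (apply cnt_spec; auto; lia).
  pose proof (mul_ge1 q hq i l H1); lia.
Qed.

Lemma chain_base_last n (x : sequence) :
  x (base q (S n) * q ^ val q (S n) - 1)%nat = x n.
Proof.
  destruct (base_val_spec q hq (S n)) as (D & _); [lia|].
  rewrite <- D; f_equal; lia.
Qed.

(** A word of length [n] amounts to a family of words, one of length [cnt q i n] for each chain, so
    a sum of products is a product of sums. Counting prefixes and bounding moments are both
    instances. *)
Lemma chain_sum (g : nat -> word -> R) (n N : nat) : (n <= N)%nat ->
  lsum (words m n) (fun u => lprod (bases q N) (fun i => g i (chain i (cnt q i n) (toseq u)))) =
  lprod (bases q N) (fun i => lsum (words m (cnt q i n)) (g i)).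
Proof.
  revert g; induction n as [|n IH]; intros g Hn.
  - cbn [words cnt]; rewrite lsum_cons, lsum_nil, Rplus_0_r.
    apply lprod_ext; intros i _. rewrite lsum_cons, lsum_nil, Rplus_0_r; reflexivity.
  - set (i0 := base q (S n)).
    (* [g'] absorbs the sum over the new letter into the factor of the only chain that it lengthens,
       which brings the sum back to length [n]. *)
    pose (g' := fun i v => if Nat.eq_dec i i0 then lsum (seq 0 m) (fun a => g i (v ++ [a])) else g i v).
    assert (Hi0 : In i0 (bases q N)) by (apply base_in_bases; auto; lia).
    rewrite lsum_words_S.
    transitivity (lsum (words m n) (fun u =>
       lprod (bases q N) (fun i => g' i (chain i (cnt q i n) (toseq u))))).
    + apply lsum_ext; intros u Hu; apply words_length in Hu.
      set (v := chain i0 (cnt q i0 n) (toseq u)).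
      transitivity (lsum (seq 0 m) (fun a => lprod (bases q N) (fun i =>
         if Nat.eq_dec i i0 then g i0 (v ++ [a]) else g i (chain i (cnt q i n) (toseq u))))).
      * apply lsum_ext; intros a _; apply lprod_ext; intros i Hi.
        apply in_bases in Hi as [Hi1 Hi2]. cbn [cnt]; fold i0.
        assert (A : agree n (toseq (u ++ [a])) (toseq u)) by (rewrite <- Hu; apply toseq_app).
        destruct (Nat.eq_dec i i0) as [-> | Ne].
        -- rewrite chain_S; unfold v.
           rewrite (chain_agree i0 n _ _ (proj1 Hi1) Hi2 A).
           assert (El : toseq (u ++ [a]) (i0 * q ^ cnt q i0 n - 1)%nat = a).
           { unfold i0; rewrite cnt_base, chain_base_last, <- Hu by auto; apply toseq_app_last. }
           now rewrite El.
        -- f_equal; apply chain_agree; auto; lia.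
      * rewrite (lsum_lprod_at nat (seq 0 m) (bases q N) i0 (fun a => g i0 (v ++ [a]))
                  (fun i => g i (chain i (cnt q i n) (toseq u)))); auto using bases_NoDup.
        apply lprod_ext; intros i _; unfold g'.
        destruct (Nat.eq_dec i i0) as [-> | Ne]; reflexivity.
    + rewrite IH by lia; apply lprod_ext; intros i _; unfold g'; cbn [cnt]; fold i0.
      destruct (Nat.eq_dec i i0) as [-> | Ne]; auto. now rewrite lsum_words_S.
Qed.

End Chains.

(** * Prefixes *)

Section Prefixes.
Context (m : nat) (Omega : sset).
Context (hS : forall x, Omega x -> inSigma m x) (hne : exists x, Omega x).

Lemma Pref_nil : Pref Omega [].
Proof.
  destruct hne as [x Hx]; split; auto; exists x; split; auto; intros i Hi; simpl in Hi; lia.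
Qed.

Lemma Pref_app u a : Pref Omega (u ++ [a]) -> Pref Omega u /\ (a < m)%nat.
Proof.
  intros [_ (x & Hx & Hs)]; rewrite starts_with_agree, length_app in Hs; simpl in Hs; split.
  - split; auto; exists x; split; auto; apply starts_with_agree.
    eapply agree_trans; [eapply agree_le; [|apply Hs]; lia | apply toseq_app].
  - rewrite <- (toseq_app_last u a), <- Hs by lia; now apply hS.
Qed.

Lemma Pref_child u : Pref Omega u -> exists a, (a < m)%nat /\ Pref Omega (u ++ [a]).
Proof.
  intros [_ (x & Hx & Hs)]; exists (x (length u)); split; [now apply hS|].
  split; auto; exists x; split; auto; intros i Hi; rewrite length_app in Hi; simpl in Hi.
  change (x i = toseq (u ++ [x (length u)]) i).
  destruct (Nat.eq_dec i (length u)) as [-> | Ne]; [now rewrite toseq_app_last|].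
  rewrite toseq_app by lia; apply Hs; lia.
Qed.

Lemma Pref_in_words u : Pref Omega u -> In u (words m (length u)).
Proof.
  intros [_ (x & Hx & Hs)]; apply in_words; split; auto.
  intros i Hi; unfold toseq; rewrite <- Hs by auto; now apply hS.
Qed.

Lemma Pref_k_length k u : length u = k -> (Pref_k Omega k u <-> Pref Omega u).
Proof. intros <-; reflexivity. Qed.

Lemma card_Pref_ind k :
  INR (card_Pref_k m Omega k) = lsum (words m k) (fun u => ind (Pref Omega u)).
Proof.
  unfold card_Pref_k; rewrite length_filter_ind; apply lsum_ext; intros u Hu.
  apply ind_iff, Pref_k_length, words_length with m; auto.
Qed.

Lemma nchild_ind u : INR (nchild m Omega u) = lsum (seq 0 m) (fun j => ind (Pref Omega (u ++ [j]))).
Proof. apply length_filter_ind. Qed.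

Lemma ind_Pref_app u a : ind (Pref Omega (u ++ [a])) = ind (Pref Omega u) * ind (Pref Omega (u ++ [a])).
Proof.
  destruct (classic (Pref Omega (u ++ [a]))) as [H | H].
  - rewrite (ind_true _ H), (ind_true (Pref Omega u)); [lra | apply (proj1 (Pref_app _ _ H))].
  - rewrite (ind_false _ H); lra.
Qed.

Lemma nchild_ge1 u : Pref Omega u -> 1 <= INR (nchild m Omega u).
Proof.
  intros H; destruct (Pref_child u H) as (a & Ha & Pa); rewrite nchild_ind, <- (ind_true _ Pa).
  apply (lsum_ge_term _ _ (fun j => ind (Pref Omega (u ++ [j])))).
  - intros; apply ind_bounds.
  - apply in_seq; lia.
Qed.

Lemma nchild_le u : INR (nchild m Omega u) <= INR m.
Proof.
  replace (INR m) with (lsum (seq 0 m) (fun _ => 1)) by (rewrite lsum_const, length_seq; lra).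
  rewrite nchild_ind; apply lsum_le; intros; apply ind_bounds.
Qed.

Lemma card_Pref_S k :
  INR (card_Pref_k m Omega (S k)) =
  lsum (words m k) (fun u => ind (Pref Omega u) * INR (nchild m Omega u)).
Proof.
  rewrite card_Pref_ind, lsum_words_S; apply lsum_ext; intros u _.
  rewrite nchild_ind, <- lsum_scal; apply lsum_ext; intros a _; apply ind_Pref_app.
Qed.

Lemma card_Pref_0 : INR (card_Pref_k m Omega 0) = 1.
Proof.
  rewrite card_Pref_ind; cbn [words]; rewrite lsum_cons, lsum_nil, ind_true; [lra | apply Pref_nil].
Qed.

Lemma card_Pref_step k :
  INR (card_Pref_k m Omega k) <= INR (card_Pref_k m Omega (S k)) <= INR m * INR (card_Pref_k m Omega k).
Proof.
  rewrite card_Pref_S, card_Pref_ind, <- lsum_scal; split; apply lsum_le; intros u _;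
    destruct (classic (Pref Omega u)) as [H | H];
    [rewrite ind_true by auto | rewrite ind_false by auto | rewrite ind_true by auto | rewrite ind_false by auto];
    try lra.
  - pose proof (nchild_ge1 u H); lra.
  - pose proof (nchild_le u); lra.
Qed.

Lemma card_Pref_ge1 k : 1 <= INR (card_Pref_k m Omega k).
Proof.
  induction k as [|k IH]; [rewrite card_Pref_0; lra|].
  pose proof (card_Pref_step k); lra.
Qed.

End Prefixes.

(** * Prefixes and closedness of [X_Omega] *)

Section XOmega.
Context (m q : nat) (Omega : sset) (hq : (2 <= q)%nat).
Context (hS : forall x, Omega x -> inSigma m x) (hne : exists x, Omega x).

Lemma X_Omega_Pref x i k : X_Omega m q Omega x -> (1 <= i)%nat -> (i mod q <> 0)%nat ->
  Pref Omega (chain q i k x).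
Proof.
  intros [_ HX] H1 H2; specialize (HX i H1 H2); split; auto.
  exists (fun l => x (i * q ^ l - 1)%nat); split; auto.
  apply (starts_with_prefix k (fun l => x (i * q ^ l - 1)%nat)).
Qed.

Lemma X_Omega_seq_closed : seq_closed Omega -> seq_closed (X_Omega m q Omega).
Proof.
  intros HC x Hx; split.
  - intros k; destruct (Hx (S k)) as (y & [Hy _] & A); rewrite A by lia; auto.
  - intros i H1 H2; apply HC; intros k.
    destruct (Hx (i * q ^ k)%nat) as (y & [_ Hy] & A).
    exists (fun l => y (i * q ^ l - 1)%nat); split; auto.
    intros l Hl; apply A.
    assert (q ^ l < q ^ k)%nat by (apply Nat.pow_lt_mono_r; lia).
    pose proof (mul_ge1 q hq i l H1); nia.
Qed.

(* The coordinates off [1..n] are filled in independently along each chain. *)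
Lemma X_Omega_extend u n : length u = n ->
  (forall i, (1 <= i <= n)%nat -> (i mod q <> 0)%nat ->
     Pref Omega (chain q i (cnt q i n) (toseq u))) ->
  exists x, X_Omega m q Omega x /\ starts_with x u.
Proof.
  intros Hu HP.
  assert (Hc : forall i, exists y, Omega y /\ ((1 <= i)%nat -> (i mod q <> 0)%nat ->
                 starts_with y (chain q i (cnt q i n) (toseq u)))).
  { intros i; destruct (classic ((1 <= i)%nat /\ (i mod q <> 0)%nat)) as [[H1 H2] | H].
    - assert (P : Pref Omega (chain q i (cnt q i n) (toseq u))).
      { destruct (le_lt_dec i n); [apply HP; auto|].
        rewrite cnt_large by auto; now apply Pref_nil. }
      destruct P as [_ (y & Hy & Hs)]; exists y; auto.
    - destruct hne as [y Hy]; exists y; split; auto; tauto. }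
  apply fun_choice in Hc as [y Hy].
  pose (x := fun k => y (base q (S k)) (val q (S k))).
  assert (E : forall i l, (1 <= i)%nat -> (i mod q <> 0)%nat -> x (i * q ^ l - 1)%nat = y i l).
  { intros i l H1 H2; unfold x; pose proof (mul_ge1 q hq i l H1).
    replace (S (i * q ^ l - 1)) with (i * q ^ l)%nat by lia.
    rewrite base_chain, val_chain; auto. }
  exists x; split; [split|].
  - intros k; unfold x; apply hS, Hy.
  - intros i H1 H2; replace (fun l => x (i * q ^ l - 1)%nat) with (y i); [apply Hy|].
    apply functional_extensionality; intros l; symmetry; auto.
  - intros k Hk; destruct (base_val_spec q hq (S k)) as (D & H1 & H2); [lia|].
    destruct (Hy (base q (S k))) as [_ Hs]; specialize (Hs H1 H2).
    assert (L : (val q (S k) < cnt q (base q (S k)) n)%nat) by (apply cnt_spec; auto; lia).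
    unfold x; rewrite Hs by (rewrite chain_length; auto).
    change (toseq (chain q (base q (S k)) (cnt q (base q (S k)) n) (toseq u)) (val q (S k)) = toseq u k).
    unfold chain; rewrite (toseq_prefix _ (fun l => toseq u (base q (S k) * q ^ l - 1)%nat)) by auto.
    now apply chain_base_last.
Qed.

Lemma X_Omega_prefix_iff u n : In u (words m n) ->
  ((exists x, X_Omega m q Omega x /\ starts_with x u) <->
   forall i, In i (bases q n) -> Pref Omega (chain q i (cnt q i n) (toseq u))).
Proof.
  intros Hu; apply words_length in Hu; split.
  - intros (x & Hx & Hs) i Hi; apply in_bases in Hi as [H1 H2].
    rewrite starts_with_agree, Hu in Hs.
    rewrite <- (chain_agree q hq i n x) by (auto; lia). apply X_Omega_Pref; auto; lia.
  - intros H; apply X_Omega_extend with n; auto. intros; apply H, in_bases; auto.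
Qed.

End XOmega.

(** * Existence of the vector [t] *)

Lemma ln_mono x y : 0 < x -> x <= y -> ln x <= ln y.
Proof. intros Hx [H | ->]; [apply Rlt_le, ln_increasing; auto | lra]. Qed.

Lemma Rabs_le_bounds x a : Rabs x <= a -> - a <= x <= a.
Proof. intros H; pose proof (Rle_abs x); pose proof (Rle_abs (- x)) as H'; rewrite Rabs_Ropp in H'; lra. Qed.

Lemma Un_cv_const (c : R) : Un_cv (fun _ => c) c.
Proof. intros eps He; exists O; intros n _; unfold Rdist; rewrite Rminus_diag, Rabs_R0; auto. Qed.

Lemma Un_cv_shift (f : nat -> R) l : Un_cv f l -> Un_cv (fun n => f (S n)) l.
Proof. intros H eps He; destruct (H eps He) as [N HN]; exists N; intros n Hn; apply HN; lia. Qed.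

Lemma Un_cv_ext (f g : nat -> R) l : (forall n, f n = g n) -> Un_cv f l -> Un_cv g l.
Proof. intros E H eps He; destruct (H eps He) as [N HN]; exists N; intros n Hn; rewrite <- E; auto. Qed.

Lemma Un_cv_pow (f : nat -> R) l k : Un_cv f l -> Un_cv (fun n => f n ^ k) (l ^ k).
Proof. intros H; induction k as [|k IH]; simpl; [apply Un_cv_const | apply CV_mult; auto]. Qed.

Lemma Un_cv_lsum A (L : list A) (f : nat -> A -> R) (g : A -> R) :
  (forall a, In a L -> Un_cv (fun n => f n a) (g a)) ->
  Un_cv (fun n => lsum L (f n)) (lsum L g).
Proof.
  induction L as [|a L IH]; intros H; [apply (Un_cv_const 0)|].
  apply (CV_plus (fun n => f n a) (fun n => lsum L (f n))).
  - apply H; now left.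
  - apply IH; intros; apply H; now right.
Qed.

Lemma Un_cv_bounds (f : nat -> R) l a b : (forall n, a <= f n <= b) -> Un_cv f l -> a <= l <= b.
Proof.
  intros H Hl; split.
  - apply Rle_cv_lim with (fun _ => a) f; auto using Un_cv_const; apply H.
  - apply Rle_cv_lim with f (fun _ => b); auto using Un_cv_const; apply H.
Qed.

Section Existence.
Context (m q : nat) (Omega : sset).
Context (hm : (2 <= m)%nat) (hq : (2 <= q)%nat).
Context (hS : forall x, Omega x -> inSigma m x).

Let top : R := Rpower (INR m) (/ INR (q - 1)).

Lemma INR_q_pred : INR (q - 1) = INR q - 1.
Proof. rewrite minus_INR by lia; reflexivity. Qed.

Lemma ln_top : ln top = ln (INR m) / (INR q - 1).
Proof. unfold top, Rpower; rewrite ln_exp, INR_q_pred; unfold Rdiv; ring. Qed.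

Lemma top_ge1 : 1 <= top.
Proof.
  pose proof (ln_m_pos m hm); pose proof (INR_q_ge2 q hq).
  assert (0 < / (INR q - 1)) by (apply Rinv_0_lt_compat; lra).
  unfold top, Rpower; rewrite INR_q_pred; apply Rle_trans with (exp 0); [rewrite exp_0; lra|].
  apply Rlt_le, exp_increasing, Rmult_lt_0_compat; auto.
Qed.

(** [top] solves [y ^ q = m * y], the equation of a vertex with all [m] children; the constant
    vector [top] is therefore a supersolution of the system. *)
Lemma top_pow : top ^ q = INR m * top.
Proof.
  pose proof (INR_m_ge2 m hm); pose proof (INR_q_ge2 q hq).
  assert (E : top ^ (q - 1) = INR m).
  { rewrite <- Rpower_pow by (unfold top, Rpower; apply exp_pos).
    unfold top; rewrite Rpower_mult, Rinv_l, Rpower_1; rewrite ?INR_q_pred; lra. }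
  transitivity (top ^ S (q - 1)); [f_equal; lia | simpl; rewrite E; ring].
Qed.

Lemma child_sum_bounds (s : word -> R) u : Pref Omega u ->
  (forall v, Pref Omega v -> 1 <= s v <= top) ->
  1 <= child_sum m Omega s u <= INR m * top.
Proof.
  intros Hu Hs; pose proof top_ge1.
  change (child_sum m Omega s u) with
    (lsum (seq 0 m) (fun j => if dec (Pref Omega (u ++ [j])) then s (u ++ [j]) else 0)).
  assert (B : forall j, 0 <= (if dec (Pref Omega (u ++ [j])) then s (u ++ [j]) else 0) <= top).
  { intros j; destruct (dec _) eqn:E; [|lra]. apply (proj1 (dec_iff _)) in E; specialize (Hs _ E); lra. }
  split.
  - destruct (Pref_child m Omega hS u Hu) as (a & Ha & Pa).
    apply Rle_trans with (if dec (Pref Omega (u ++ [a])) then s (u ++ [a]) else 0).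
    + rewrite dec_true by auto; now apply Hs.
    + apply (lsum_ge_term _ _ (fun j => if dec (Pref Omega (u ++ [j])) then s (u ++ [j]) else 0)).
      * intros; apply B.
      * apply in_seq; lia.
  - replace (INR m * top) with (lsum (seq 0 m) (fun _ => top)) by now rewrite lsum_const, length_seq.
    apply lsum_le; intros; apply B.
Qed.

(** Monotone iteration from the supersolution [top]: on prefixes the iterates decrease and stay at
    least 1, because every prefix has a child. Their pointwise limit is the solution. *)
Fixpoint iterate (n : nat) (u : word) : R :=
  match n with
  | O => top
  | S n' => Rpower (child_sum m Omega (iterate n') u) (/ INR q)
  end.

Lemma root_pow y : 0 < y -> Rpower y (/ INR q) ^ q = y.
Proof.
  intros Hy; pose proof (INR_q_ge2 q hq).
  rewrite <- Rpower_pow by (unfold Rpower; apply exp_pos).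
  rewrite Rpower_mult, Rinv_l by lra; apply Rpower_1; auto.
Qed.

Lemma iterate_bounds n u : Pref Omega u -> 1 <= iterate n u <= top.
Proof.
  pose proof (INR_q_ge2 q hq) as Hq; pose proof top_ge1 as Ht.
  assert (Hi : 0 <= / INR q) by (apply Rlt_le, Rinv_0_lt_compat; lra).
  revert u; induction n as [|n IH]; intros u Hu; simpl; [lra|].
  destruct (child_sum_bounds (iterate n) u Hu IH) as [H1 H2]; split.
  - replace 1 with (Rpower 1 (/ INR q)).
    + apply Rle_Rpower_l; lra.
    + unfold Rpower; rewrite ln_1, Rmult_0_r, exp_0; auto.
  - rewrite <- top_pow in H2.
    replace top with (Rpower (top ^ q) (/ INR q)).
    + apply Rle_Rpower_l; lra.
    + rewrite <- Rpower_pow, Rpower_mult, Rinv_r, Rpower_1; lra.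
Qed.

Lemma iterate_decreasing n u : Pref Omega u -> iterate (S n) u <= iterate n u.
Proof.
  pose proof (INR_q_ge2 q hq) as Hq; pose proof top_ge1 as Ht.
  revert u; induction n as [|n IH]; intros u Hu.
  - apply (iterate_bounds 1 u Hu).
  - change (Rpower (child_sum m Omega (iterate (S n)) u) (/ INR q) <=
            Rpower (child_sum m Omega (iterate n) u) (/ INR q)).
    pose proof (child_sum_bounds _ u Hu (iterate_bounds (S n))).
    apply Rle_Rpower_l; [apply Rlt_le, Rinv_0_lt_compat; lra | split; [lra|]].
    apply lsum_le; intros j _; destruct (dec _) eqn:E; [|lra].
    apply IH; now apply dec_iff.
Qed.

Lemma tvec_exists : exists t, tvec m q Omega t.
Proof.
  pose proof top_ge1 as Ht.
  assert (L : forall u, exists l, Pref Omega u -> Un_cv (fun n => iterate n u) l).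
  { intros u; destruct (classic (Pref Omega u)) as [Hu | Hu]; [|exists 0; tauto].
    destruct (decreasing_cv (fun n => iterate n u)) as [l Hl].
    - intros n; apply iterate_decreasing; auto.
    - exists (-1); intros x (n & ->); unfold opp_seq.
      pose proof (iterate_bounds n u Hu); lra.
    - now exists l. }
  apply fun_choice in L as [t Hcv]; exists t; intros u Hu; split.
  - apply Un_cv_bounds with (fun n => iterate n u); auto. intros; now apply iterate_bounds.
  - apply UL_sequence with (fun n => iterate (S n) u ^ q).
    + apply Un_cv_pow, Un_cv_shift with (f := fun n => iterate n u); auto.
    + apply Un_cv_ext with (fun n => child_sum m Omega (iterate n) u).
      * intros n; symmetry; apply root_pow.
        pose proof (child_sum_bounds _ u Hu (iterate_bounds n)); lra.
      * apply Un_cv_lsum with (f := fun n j => if dec (Pref Omega (u ++ [j])) then iterate n (u ++ [j]) else 0).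
        intros j _; destruct (dec _) eqn:E; [|apply Un_cv_const]. apply Hcv; now apply dec_iff.
Qed.

End Existence.

(** * The Minkowski dimension *)

Lemma lprod_ind A (l : list A) (P : A -> Prop) :
  lprod l (fun a => ind (P a)) = ind (forall a, In a l -> P a).
Proof.
  destruct (classic (forall a, In a l -> P a)) as [H | H].
  - rewrite (ind_true _ H); apply lprod_one; intros; now apply ind_true, H.
  - rewrite (ind_false _ H). apply not_all_ex_not in H as [a H]; apply imply_to_and in H as [Ha H].
    apply lprod_zero with a; auto; now apply ind_false.
Qed.

(** Summation by parts trades the increments seen by positions for the values that appear in the
    series of the theorem. It is applied to [ln_card] and to [gap]; the boundary term vanishes in
    the limit when [a] grows at most linearly. *)
Lemma abel_summation (q : R) (a : nat -> R) L : 0 < q -> a O = 0 ->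
  (1 - / q) * lsum (seq 0 L) (fun l => (a (S l) - a l) / q ^ l) =
  (q - 1) ^ 2 * lsum (seq 0 L) (fun k => a (S k) / q ^ (S k + 1)) + (1 - / q) * (a L / q ^ L).
Proof.
  intros Hq H0; induction L as [|L IH].
  - simpl (seq 0 0); rewrite !lsum_nil, H0; simpl; field; lra.
  - rewrite !lsum_seq_S, !Rmult_plus_distr_l, IH; simpl (0 + L)%nat.
    rewrite Nat.add_1_r; simpl; field; split; [apply pow_nonzero|]; lra.
Qed.

Lemma Un_cv_unshift (f : nat -> R) l : Un_cv (fun n => f (S n)) l -> Un_cv f l.
Proof.
  intros H eps He; destruct (H eps He) as [N HN]; exists (S N); intros [|n] Hn; [lia|].
  apply HN; lia.
Qed.

Lemma linear_over_pow_small (q : nat) (B eps : R) : (2 <= q)%nat -> 0 <= B -> 0 < eps ->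
  exists L0, forall L, (L0 <= L)%nat -> B * INR L / INR q ^ L < eps.
Proof.
  intros hq HB He; pose proof (INR_q_ge2 q hq) as Hq.
  set (eta := ln (INR q)).
  assert (Heta : 0 < eta) by (unfold eta; rewrite <- ln_1; apply ln_increasing; lra).
  destruct (exp_small (eta / 2) (eps / (B * (2 / eta) + 1))) as [L0 H]; [lra| |].
  { apply Rdiv_lt_0_compat; auto. assert (0 < 2 / eta) by (apply Rdiv_lt_0_compat; lra). nra. }
  exists L0; intros L HL; specialize (H L HL).
  (* Half of the exponential decay absorbs the factor [L], the other half makes the product
     small. *)
  assert (E : / INR q ^ L = exp (- (eta / 2) * INR L) * exp (- (eta / 2) * INR L)).
  { rewrite <- exp_plus; replace (_ + _) with (- (INR L * eta)) by field.
    rewrite exp_Ropp; f_equal; change (INR q ^ L = Rpower (INR q) (INR L)); rewrite Rpower_pow; lra. }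
  set (e := exp (- (eta / 2) * INR L)) in *.
  assert (Pe : 0 < e) by apply exp_pos.
  assert (Le : INR L * e <= 2 / eta).
  { assert (X : exp (eta / 2 * INR L) * e = 1) by (unfold e; rewrite <- exp_plus, <- exp_0; f_equal; ring).
    pose proof (exp_ineq1_le (eta / 2 * INR L)).
    assert (eta / 2 * (INR L * e) <= 1).
    { apply Rle_trans with (exp (eta / 2 * INR L) * e); [|lra].
      rewrite <- Rmult_assoc; apply Rmult_le_compat_r; lra. }
    apply Rmult_le_reg_l with (eta / 2); [lra|]. replace (eta / 2 * (2 / eta)) with 1 by (field; lra). lra. }
  unfold Rdiv; rewrite E.
  assert (Q0 : 0 <= B * (2 / eta)) by (apply Rmult_le_pos; [lra | apply Rlt_le, Rdiv_lt_0_compat; lra]).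
  apply Rle_lt_trans with ((B * (2 / eta)) * e).
  - replace (B * INR L * (e * e)) with (B * (INR L * e) * e) by ring.
    apply Rmult_le_compat_r; [lra|]. apply Rmult_le_compat_l; lra.
  - apply (Rmult_lt_compat_l (B * (2 / eta) + 1)) in H; [|lra].
    replace ((B * (2 / eta) + 1) * (eps / (B * (2 / eta) + 1))) with eps in H by (field; lra). lra.
Qed.

Section Minkowski.
Context (m q : nat) (Omega : sset).
Context (hm : (2 <= m)%nat) (hq : (2 <= q)%nat).
Context (hS : forall x, Omega x -> inSigma m x) (hne : exists x, Omega x).

Definition ln_card (k : nat) : R := ln (INR (card_Pref_k m Omega k)).
Definition dln_card (k : nat) : R := ln_card (S k) - ln_card k.

Lemma ln_card_0 : ln_card 0 = 0.
Proof. unfold ln_card; rewrite card_Pref_0, ln_1; auto. Qed.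

Lemma dln_card_bounds k : 0 <= dln_card k <= ln (INR m).
Proof.
  pose proof (card_Pref_ge1 m Omega hS hne k); pose proof (card_Pref_step m Omega hS k) as [H1 H2].
  pose proof (INR_m_ge2 m hm); unfold dln_card, ln_card; split.
  - apply ln_mono in H1; lra.
  - apply ln_mono in H2; [|lra]. rewrite ln_mult in H2; lra.
Qed.

Lemma dln_card_abs k : Rabs (dln_card k) <= ln (INR m).
Proof. pose proof (dln_card_bounds k); rewrite Rabs_pos_eq; lra. Qed.

Lemma ln_card_bounds k : 0 <= ln_card k <= INR k * ln (INR m).
Proof.
  induction k as [|k IH]; [rewrite ln_card_0; simpl; lra|].
  pose proof (dln_card_bounds k); unfold dln_card in *; rewrite S_INR; lra.
Qed.

Definition dln_card_partial (L : nat) : R :=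
  (1 - / INR q) * lsum (seq 0 L) (fun l => dln_card l / INR q ^ l).

(** The terms are nonnegative, and summation by parts bounds the partial sums because the increments
    [dln_card] are at most [ln m]. The same identity carries the limit over to
    [dln_card_partial]. *)
Lemma card_series : exists l,
  infinite_sum (fun k => logm m (INR (card_Pref_k m Omega (S k))) / INR q ^ (S k + 1)) l /\
  Un_cv dln_card_partial ((INR q - 1) ^ 2 * l * ln (INR m)).
Proof.
  pose proof (INR_q_ge2 q hq) as Hq; pose proof (ln_m_pos m hm) as Lm.
  set (f := fun k => logm m (INR (card_Pref_k m Omega (S k))) / INR q ^ (S k + 1)).
  assert (Ef : forall k, f k = / ln (INR m) * (ln_card (S k) / INR q ^ (S k + 1))).
  { intros k; unfold f, logm, ln_card; field; split; [apply pow_nonzero|]; lra. }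
  assert (f0 : forall k, 0 <= f k).
  { intros k; rewrite Ef; pose proof (ln_card_bounds (S k)).
    apply Rmult_le_pos; [apply Rlt_le, Rinv_0_lt_compat; lra|].
    apply Rmult_le_pos; [lra | apply Rlt_le, Rinv_0_lt_compat, pow_lt; lra]. }
  assert (Q1 : 0 < 1 - / INR q).
  { assert (/ INR q <= / 2) by (apply Rinv_le_contravar; lra). lra. }
  assert (AB : forall L, dln_card_partial L =
     (INR q - 1) ^ 2 * ln (INR m) * lsum (seq 0 L) f + (1 - / INR q) * (ln_card L / INR q ^ L)).
  { intros L; unfold dln_card_partial, dln_card.
    rewrite (abel_summation _ ln_card) by (lra || apply ln_card_0); f_equal.
    rewrite (lsum_ext _ _ f _ (fun k _ => Ef k)), lsum_scal; field; lra. }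
  assert (B : forall L, 0 <= dln_card_partial L <= ln (INR m)).
  { intros L; unfold dln_card_partial.
    assert (X : forall l, 0 <= dln_card l / INR q ^ l <= ln (INR m) * / INR q ^ l).
    { intros l; pose proof (dln_card_bounds l).
      assert (0 < / INR q ^ l) by (apply Rinv_0_lt_compat, pow_lt; lra). unfold Rdiv; nra. }
    split.
    - apply Rmult_le_pos; [lra|]. apply lsum_nonneg; intros; apply X.
    - apply Rle_trans with ((1 - / INR q) * (ln (INR m) * lsum (seq 0 L) (fun l => / INR q ^ l))).
      + apply Rmult_le_compat_l; [lra|]. rewrite <- lsum_scal; apply lsum_le; intros; apply X.
      + pose proof (geometric_bound q hq L). nra. }
  assert (T0 : forall L, 0 <= (1 - / INR q) * (ln_card L / INR q ^ L)).
  { intros L; pose proof (ln_card_bounds L); apply Rmult_le_pos; [lra|].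
    apply Rmult_le_pos; [lra | apply Rlt_le, Rinv_0_lt_compat, pow_lt; lra]. }
  assert (P : 0 < (INR q - 1) ^ 2 * ln (INR m)) by (apply Rmult_lt_0_compat; [apply pow_lt|]; lra).
  destruct (growing_cv (fun n => sum_f_R0 f n)) as [l Hl].
  - intros n; simpl; specialize (f0 (S n)); lra.
  - exists (/ (INR q - 1) ^ 2); intros x (n & ->); rewrite sum_f_R0_lsum.
    specialize (B (S n)); rewrite AB in B; specialize (T0 (S n)).
    apply Rmult_le_reg_l with ((INR q - 1) ^ 2 * ln (INR m)); auto.
    replace ((INR q - 1) ^ 2 * ln (INR m) * / (INR q - 1) ^ 2) with (ln (INR m)) by (field; lra).
    lra.
  - exists l; split; [exact Hl|].
    assert (Hl' : Un_cv (fun L => lsum (seq 0 L) f) l).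
    { apply Un_cv_unshift; eapply Un_cv_ext; [|apply Hl]; intros n; apply sum_f_R0_lsum. }
    apply Un_cv_ext with (fun L => (INR q - 1) ^ 2 * ln (INR m) * lsum (seq 0 L) f
                                   + (1 - / INR q) * (ln_card L / INR q ^ L)); [intros; now rewrite AB|].
    replace ((INR q - 1) ^ 2 * l * ln (INR m)) with ((INR q - 1) ^ 2 * ln (INR m) * l + 0) by ring.
    apply CV_plus; [apply CV_mult; auto using Un_cv_const|].
    intros eps He; destruct (linear_over_pow_small q (ln (INR m)) eps hq) as [L0 H]; [lra | auto |].
    exists L0; intros L HL; specialize (H L HL); unfold Rdist; rewrite Rminus_0_r, Rabs_pos_eq by auto.
    eapply Rle_lt_trans; [|apply H].
    assert (I1 : 0 < / INR q) by (apply Rinv_0_lt_compat; lra).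
    assert (Pq : 0 < / INR q ^ L) by (apply Rinv_0_lt_compat, pow_lt; lra).
    pose proof (ln_card_bounds L).
    apply Rle_trans with (1 * (ln_card L / INR q ^ L)).
    + apply Rmult_le_compat_r; [apply Rmult_le_pos|]; lra.
    + rewrite Rmult_1_l; apply Rmult_le_compat_r; lra.
Qed.

Definition X_prefixes (n : nat) : list word :=
  filter (fun u => dec (exists x, X_Omega m q Omega x /\ starts_with x u)) (words m n).

Lemma X_prefixes_length n :
  INR (length (X_prefixes n)) = exp (lsum (seq 1 n) (fun p => dln_card (val q p))).
Proof.
  unfold X_prefixes; rewrite length_filter_ind.
  pose (g := fun (_ : nat) v => ind (Pref Omega v)).
  rewrite (lsum_ext _ _ _ (fun u => lprod (bases q n) (fun i => g i (chain q i (cnt q i n) (toseq u))))).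
  - rewrite chain_sum by auto.
    rewrite (lprod_ext _ _ _ (fun i => exp (ln_card (cnt q i n)))).
    + rewrite (lprod_bases q hq (fun _ k => exp (ln_card k)) (fun _ k => exp (dln_card k))); auto.
      * apply lprod_exp.
      * intros _; rewrite ln_card_0; apply exp_0.
      * intros _ k; rewrite <- exp_plus; f_equal; unfold dln_card; ring.
    + intros i _; unfold g; rewrite <- card_Pref_ind; unfold ln_card.
      rewrite exp_ln; auto. pose proof (card_Pref_ge1 m Omega hS hne (cnt q i n)); lra.
  - intros u Hu; unfold g; rewrite lprod_ind; apply ind_iff, X_Omega_prefix_iff; auto.
Qed.

Lemma in_X_prefixes n u : In u (X_prefixes n) <->
  In u (words m n) /\ exists x, X_Omega m q Omega x /\ starts_with x u.
Proof. unfold X_prefixes; rewrite filter_In, dec_iff; tauto. Qed.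

Lemma cover_by_prefixes n r : / INR m ^ n <= r -> CoverN m r (X_Omega m q Omega) (length (X_prefixes n)).
Proof.
  intros Hr; exists (fun i x => X_Omega m q Omega x /\ starts_with x (nth i (X_prefixes n) [])).
  split; [|split].
  - now intros i x _ [[H _] _].
  - intros i Hi; eapply Rle_trans; [|apply Hr]; apply diam_cylinder; auto.
    pose proof (nth_In (X_prefixes n) [] Hi) as Hin; apply in_X_prefixes in Hin as [Hw _].
    apply words_length in Hw.
    intros x y [_ Hx] [_ Hy]; rewrite starts_with_agree, Hw in Hx, Hy.
    eapply agree_trans; [apply Hx | apply agree_sym, Hy].
  - intros x Hx.
    assert (Hin : In (map x (seq 0 n)) (X_prefixes n)).
    { apply in_X_prefixes; split; [apply prefix_in_words, Hx|]. exists x; split; auto; apply starts_with_prefix. }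
    destruct (In_nth _ _ [] Hin) as (i & Hi & E); exists i; split; auto; split; auto.
    pose proof (starts_with_prefix n x) as Hs; rewrite <- E in Hs; exact Hs.
Qed.

(** Distances are 0 or powers of [1 / m], so a set of diameter below [m ^ (-(n-1))] meets at most
    one cylinder of length [n]. Choosing a covered point in the cylinder of each prefix thus maps
    prefixes injectively to indices of the cover. *)
Lemma cover_ge_prefixes n r k : (1 <= n)%nat -> r < / INR m ^ (n - 1) ->
  CoverN m r (X_Omega m q Omega) k -> (length (X_prefixes n) <= k)%nat.
Proof.
  intros Hn Hr (U & _ & HD & HC).
  assert (Hc : forall u, exists z : nat * sequence, In u (X_prefixes n) ->
     (fst z < k)%nat /\ U (fst z) (snd z) /\ agree n (snd z) (toseq u)).
  { intros u; destruct (classic (In u (X_prefixes n))) as [Hu | Hu]; [|exists (O, fun _ => O); tauto].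
    pose proof Hu as Hu'; apply in_X_prefixes in Hu' as [Hw (x & Hx & Hs)]; apply words_length in Hw.
    destruct (HC x Hx) as (i & Hi & Ui); exists (i, x); intros _; repeat split; auto.
    rewrite <- Hw; apply Hs. }
  apply fun_choice in Hc as [z Hz].
  assert (Inj : forall u v, In u (X_prefixes n) -> In v (X_prefixes n) -> fst (z u) = fst (z v) -> u = v).
  { intros u v Hu Hv E; destruct (Hz u Hu) as (Ku & Uu & Au); destruct (Hz v Hv) as (Kv & Uv & Av).
    rewrite <- E in Uv.
    assert (D : dist m (snd (z u)) (snd (z v)) <= r) by (eapply Rle_trans; [apply dist_le_diam; eauto | auto]).
    assert (A : agree n (snd (z u)) (snd (z v))).
    { apply (dist_le_iff m hm). destruct (dist_cases m (snd (z u)) (snd (z v))) as [-> | (p & Ep)].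
      - apply Rlt_le, inv_pow_pos; auto.
      - rewrite Ep in *; apply (inv_pow_le_iff m hm).
        destruct (le_lt_dec n p) as [|Hl]; auto; exfalso.
        assert (/ INR m ^ (n - 1) <= / INR m ^ p) by (apply (inv_pow_le_iff m hm); lia). lra. }
    apply in_X_prefixes in Hu as [Hu _]; apply in_X_prefixes in Hv as [Hv _].
    apply words_length in Hu, Hv; apply list_eq_toseq; [lia|]. rewrite Hu.
    eapply agree_trans; [apply agree_sym, Au|]. eapply agree_trans; eauto. }
  rewrite <- (length_map (fun u => fst (z u))), <- (length_seq k 0).
  apply NoDup_incl_length.
  - apply Injective_map_NoDup_in; auto. apply NoDup_filter, words_NoDup.
  - intros i Hi; apply in_map_iff in Hi as (u & <- & Hu); apply in_seq. destruct (Hz u Hu); lia.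
Qed.

Lemma MinCover_prefixes n r k : (1 <= n)%nat -> / INR m ^ n <= r < / INR m ^ (n - 1) ->
  MinCover m r (X_Omega m q Omega) k -> k = length (X_prefixes n).
Proof.
  intros Hn [H1 H2] [HC HM]; apply Nat.le_antisymm.
  - apply HM, cover_by_prefixes; auto.
  - apply cover_ge_prefixes with r; auto.
Qed.

Lemma MinCover_exists r : 0 < r -> exists n, MinCover m r (X_Omega m q Omega) n.
Proof.
  intros Hr; destruct (exists_pow_small m hm r Hr) as [p Hp].
  destruct (dec_inh_nat_subset_has_unique_least_element (CoverN m r (X_Omega m q Omega)))
    as (n & [Hn Hm] & _).
  - intros; apply classic.
  - exists (length (X_prefixes p)); now apply cover_by_prefixes.
  - exists n; split; auto.
Qed.

Lemma dimM_value d : Un_cv dln_card_partial (d * ln (INR m)) -> is_dimM m (X_Omega m q Omega) d.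
Proof.
  intros Hcv; split; [exact MinCover_exists|]. intros eps He.
  pose proof (ln_m_pos m hm) as Lm.
  set (lm := ln (INR m)) in *. set (I0 := d * lm) in *.
  destruct (lsum_val_asymptotics q hq _ _ dln_card dln_card_abs Hcv (eps * lm / 4)) as [n0 Hn0]; [nra|].
  (* with [- ln r > Y], the error [|d| lm / (- ln r)] from rounding the scale is below [eps / 4] *)
  set (Y := INR n0 * lm + 2 * lm + 4 * (Rabs d * lm) / eps + 1).
  assert (Yd : 0 <= 4 * (Rabs d * lm) / eps).
  { pose proof (Rabs_pos d); apply Rmult_le_pos; [nra | apply Rlt_le, Rinv_0_lt_compat; auto]. }
  assert (Yn : 0 <= INR n0 * lm) by (apply Rmult_le_pos; [apply pos_INR | lra]).
  exists (exp (- Y)); split; [apply exp_pos|]. intros r k [Hr0 Hr] HM.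
  set (y := - ln r).
  assert (HyY : Y < y).
  { apply ln_increasing in Hr; auto; rewrite ln_exp in Hr; unfold y; lra. }
  assert (Hr1 : r < 1).
  { apply Rlt_trans with (exp (- Y)); auto. rewrite <- exp_0; apply exp_increasing; unfold Y; lra. }
  destruct (scale_exists m hm r (conj Hr0 Hr1)) as (n & Hn1 & Hn2).
  rewrite (MinCover_prefixes n r k Hn1 Hn2 HM), X_prefixes_length, ln_exp.
  rewrite !m_pow_exp in Hn2 by auto; fold lm in Hn2.
  assert (U1 : y <= INR n * lm).
  { destruct Hn2 as [H _]; apply ln_mono in H; [|apply exp_pos]; rewrite ln_exp in H; unfold y; lra. }
  assert (U2 : (INR n - 1) * lm < y).
  { destruct Hn2 as [_ H]; apply ln_increasing in H; auto; rewrite ln_exp, minus_INR in H by auto.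
    simpl in H; unfold y; lra. }
  assert (Hnn : (n0 <= n)%nat).
  { apply INR_le, Rmult_le_reg_r with lm; auto; unfold Y in HyY; lra. }
  specialize (Hn0 n Hnn). set (A := lsum (seq 1 n) _) in *.
  assert (Py : 0 < y) by (unfold Y in HyY; lra).
  (* The error splits into that of the average at [n] and the rounding of [- ln r] to the multiple
     [n * ln m]. *)
  assert (E : A / y - d = ((A - INR n * I0) + d * (INR n * lm - y)) / y) by (unfold I0; field; lra).
  rewrite E; unfold Rdiv at 1; rewrite Rabs_mult, (Rabs_pos_eq (/ y)) by (apply Rlt_le, Rinv_0_lt_compat; auto).
  apply Rmult_lt_reg_r with y; auto. rewrite Rmult_assoc, Rinv_l, Rmult_1_r by lra.
  eapply Rle_lt_trans; [apply Rabs_triang|]. rewrite Rabs_mult.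
  rewrite (Rabs_pos_eq (INR n * lm - y)) by lra.
  assert (E1 : Rabs d * (INR n * lm - y) <= Rabs d * lm).
  { apply Rmult_le_compat_l; [apply Rabs_pos | lra]. }
  assert (E2 : Rabs d * lm <= eps / 4 * y).
  { apply Rle_trans with (eps / 4 * (4 * (Rabs d * lm) / eps)); [apply Req_le; field; lra|].
    apply Rmult_le_compat_l; [lra | unfold Y in HyY; lra]. }
  assert (E3 : eps * lm / 4 * INR n < eps / 2 * y).
  { assert (INR n * lm < 2 * y) by (unfold Y in HyY; lra).
    replace (eps * lm / 4 * INR n) with (eps / 4 * (INR n * lm)) by field.
    replace (eps / 2 * y) with (eps / 4 * (2 * y)) by field.
    apply Rmult_lt_compat_l; lra. }
  nra.
Qed.

Lemma dimM_unique d1 d2 : is_dimM m (X_Omega m q Omega) d1 -> is_dimM m (X_Omega m q Omega) d2 -> d1 = d2.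
Proof.
  intros [Hex H1] [_ H2]; apply NNPP; intros N.
  set (e := Rabs (d1 - d2) / 2).
  assert (He : 0 < e) by (unfold e; assert (0 < Rabs (d1 - d2)) by (apply Rabs_pos_lt; lra); lra).
  destruct (H1 e He) as (r1 & P1 & K1); destruct (H2 e He) as (r2 & P2 & K2).
  set (r := Rmin r1 r2 / 2).
  assert (Pm : 0 < Rmin r1 r2) by (apply Rmin_pos; auto).
  pose proof (Rmin_l r1 r2); pose proof (Rmin_r r1 r2).
  destruct (Hex r) as [n Hn]; [unfold r; lra|].
  specialize (K1 r n ltac:(unfold r; lra) Hn); specialize (K2 r n ltac:(unfold r; lra) Hn).
  set (w := ln (INR n) / - ln r) in *.
  assert (Rabs (d1 - d2) < 2 * e); [|unfold e in *; lra].
  replace (d1 - d2) with ((w - d2) - (w - d1)) by ring.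
  unfold Rminus at 1; eapply Rle_lt_trans; [apply Rabs_triang|]. rewrite Rabs_Ropp; lra.
Qed.

End Minkowski.

(** * The Markov measure with transition probabilities [t (uj) / t u ^ q] *)

Section Measure.
Context (m q : nat) (Omega : sset) (t : word -> R).
Context (hm : (2 <= m)%nat) (hq : (2 <= q)%nat).
Context (hS : forall x, Omega x -> inSigma m x) (hne : exists x, Omega x).
Context (ht : tvec m q Omega t).

Definition lt_max : R := ln (INR m) / (INR q - 1).

Lemma lt_max_pos : 0 < lt_max.
Proof.
  pose proof (ln_m_pos m hm); pose proof (INR_q_ge2 q hq).
  apply Rdiv_lt_0_compat; lra.
Qed.

Lemma t_ge1 u : Pref Omega u -> 1 <= t u.
Proof. intros H; apply ht, H. Qed.

Lemma ln_t_bounds u : Pref Omega u -> 0 <= ln (t u) <= lt_max.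
Proof.
  intros H; destruct (ht u H) as [[H1 H2] _]; split.
  - rewrite <- ln_1; apply ln_mono; lra.
  - unfold lt_max; rewrite <- ln_top by auto; apply ln_mono; lra.
Qed.

Definition pr (u : word) (j : nat) : R := ind (Pref Omega (u ++ [j])) * (t (u ++ [j]) / t u ^ q).

Lemma pr_nonneg u j : 0 <= pr u j.
Proof.
  unfold pr; destruct (classic (Pref Omega (u ++ [j]))) as [H | H].
  - rewrite ind_true by auto; pose proof (t_ge1 _ H).
    pose proof (t_ge1 _ (proj1 (Pref_app m Omega hS _ _ H))).
    rewrite Rmult_1_l; apply Rlt_le, Rdiv_lt_0_compat; [lra | apply pow_lt; lra].
  - rewrite ind_false by auto; lra.
Qed.

Lemma pr_pos u j : Pref Omega (u ++ [j]) -> 0 < pr u j.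
Proof.
  intros H; unfold pr; rewrite ind_true by auto; pose proof (t_ge1 _ H).
  pose proof (t_ge1 _ (proj1 (Pref_app m Omega hS _ _ H))).
  rewrite Rmult_1_l; apply Rdiv_lt_0_compat; [lra | apply pow_lt; lra].
Qed.

Lemma pr_zero u j : ~ Pref Omega (u ++ [j]) -> pr u j = 0.
Proof. intros H; unfold pr; rewrite ind_false by auto; lra. Qed.

Lemma ln_pr u j : Pref Omega (u ++ [j]) -> ln (pr u j) = ln (t (u ++ [j])) - INR q * ln (t u).
Proof.
  intros H; unfold pr; rewrite ind_true, Rmult_1_l by auto; pose proof (t_ge1 _ H).
  pose proof (t_ge1 _ (proj1 (Pref_app m Omega hS _ _ H))).
  assert (0 < t u ^ q) by (apply pow_lt; lra).
  unfold Rdiv; rewrite ln_mult, ln_Rinv, ln_pow; try lra. now apply Rinv_0_lt_compat.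
Qed.

Lemma pr_sum u : Pref Omega u -> lsum (seq 0 m) (pr u) = 1.
Proof.
  intros H; destruct (ht u H) as [[H1 _] E].
  assert (P : t u ^ q <> 0) by (apply pow_nonzero; lra).
  rewrite (lsum_ext _ _ _ (fun j => / t u ^ q * (if dec (Pref Omega (u ++ [j])) then t (u ++ [j]) else 0))).
  - rewrite lsum_scal.
    change (/ t u ^ q * child_sum m Omega t u = 1). rewrite <- E; field; auto.
  - intros j _; unfold pr, ind; destruct (dec _); field; auto.
Qed.

Lemma pr_le1 u j : pr u j <= 1.
Proof.
  destruct (classic (Pref Omega (u ++ [j]))) as [H | H]; [|rewrite pr_zero by auto; lra].
  destruct (Pref_app m Omega hS _ _ H) as [Hu Hj].
  rewrite <- (pr_sum u Hu); apply lsum_ge_term; [intros; apply pr_nonneg | apply in_seq; lia].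
Qed.

Definition mu (v : word) : R := lprod (seq 0 (length v)) (fun l => pr (firstn l v) (nth l v 0%nat)).

Lemma mu_nil : mu [] = 1.
Proof. reflexivity. Qed.

Lemma mu_app v j : mu (v ++ [j]) = mu v * pr v j.
Proof.
  unfold mu; rewrite length_app; simpl length; rewrite Nat.add_1_r, lprod_seq_S; f_equal.
  - apply lprod_ext; intros l Hl; apply in_seq in Hl.
    rewrite firstn_app, app_nth1 by lia.
    replace (l - length v)%nat with O by lia; simpl; now rewrite app_nil_r.
  - simpl; rewrite app_nth2, Nat.sub_diag, firstn_app, firstn_all, Nat.sub_diag by lia.
    simpl; now rewrite app_nil_r.
Qed.

Lemma mu_nonneg v : 0 <= mu v.
Proof. apply lprod_nonneg; intros; apply pr_nonneg. Qed.

Lemma mu_cases v : (Pref Omega v /\ 0 < mu v) \/ (~ Pref Omega v /\ mu v = 0).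
Proof.
  induction v as [|j v IH] using rev_ind.
  - left; split; [now apply Pref_nil | rewrite mu_nil; lra].
  - rewrite mu_app; destruct (classic (Pref Omega (v ++ [j]))) as [H | H].
    + left; split; auto. apply Rmult_lt_0_compat; [|now apply pr_pos].
      destruct IH as [[_ IH] | [N _]]; auto; destruct N; apply (Pref_app m Omega hS _ _ H).
    + right; split; auto; rewrite pr_zero by auto; lra.
Qed.

Lemma mu_pos v : Pref Omega v -> 0 < mu v.
Proof. destruct (mu_cases v); tauto. Qed.

Lemma mu_neq0 v : mu v <> 0 -> Pref Omega v.
Proof. destruct (mu_cases v); tauto. Qed.

Lemma mu_children v : lsum (seq 0 m) (fun j => mu (v ++ [j])) = mu v.
Proof.
  rewrite (lsum_ext _ _ _ (fun j => mu v * pr v j)) by (intros; apply mu_app).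
  rewrite lsum_scal; destruct (mu_cases v) as [[H _] | [_ ->]]; [|lra].
  rewrite pr_sum by auto; lra.
Qed.

Lemma mu_total k : lsum (words m k) mu = 1.
Proof.
  induction k as [|k IH]; [cbn [words]; rewrite lsum_cons, lsum_nil, mu_nil; lra|].
  rewrite lsum_words_S, <- IH; apply lsum_ext; intros; apply mu_children.
Qed.

Lemma ln_mu_bounds v : Pref Omega v -> 0 <= - ln (mu v) <= INR (length v) * (INR q * lt_max).
Proof.
  pose proof (INR_q_ge2 q hq) as Hq.
  induction v as [|j v IH] using rev_ind; intros H.
  - rewrite mu_nil, ln_1; simpl; lra.
  - destruct (Pref_app m Omega hS _ _ H) as [Hv Hj]; specialize (IH Hv).
    rewrite mu_app, ln_mult, length_app by auto using mu_pos, pr_pos.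
    simpl length; rewrite Nat.add_1_r, S_INR.
    assert (A : ln (pr v j) <= 0) by (rewrite <- ln_1; apply ln_mono; [now apply pr_pos | apply pr_le1]).
    assert (B : - ln (pr v j) <= INR q * lt_max).
    { rewrite ln_pr by auto. pose proof (ln_t_bounds _ H); pose proof (ln_t_bounds _ Hv). nra. }
    lra.
Qed.

Definition entropy (k : nat) : R := lsum (words m k) (fun v => - (mu v * ln (mu v))).
Definition mean_ln_t (k : nat) : R := lsum (words m k) (fun v => mu v * ln (t v)).

Lemma entropy_0 : entropy 0 = 0.
Proof. unfold entropy; cbn [words]; rewrite lsum_cons, lsum_nil, mu_nil, ln_1; lra. Qed.

Lemma mean_ln_t_0 : mean_ln_t 0 = ln (t []).
Proof. unfold mean_ln_t; cbn [words]; rewrite lsum_cons, lsum_nil, mu_nil; lra. Qed.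

Lemma mean_ln_t_bounds k : 0 <= mean_ln_t k <= lt_max.
Proof.
  unfold mean_ln_t; split.
  - apply lsum_nonneg; intros v _; destruct (mu_cases v) as [[H P] | [_ ->]]; [|lra].
    pose proof (ln_t_bounds v H); nra.
  - rewrite <- (Rmult_1_r lt_max), <- (mu_total k), <- lsum_scal; apply lsum_le; intros v _.
    destruct (mu_cases v) as [[H P] | [_ ->]]; [|lra].
    pose proof (ln_t_bounds v H); nra.
Qed.

(** The chain rule for entropy: the information of a single step is given by [ln_pr], and
    [mu_children] turns the mean of [ln (t v)] over children back into one over their parents. *)
Lemma entropy_S k : entropy (S k) - entropy k = INR q * mean_ln_t k - mean_ln_t (S k).
Proof.
  unfold entropy, mean_ln_t; rewrite !lsum_words_S, <- lsum_minus, <- lsum_scal, <- lsum_minus.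
  apply lsum_ext; intros v _.
  rewrite (lsum_ext _ _ (fun a => - (mu (v ++ [a]) * ln (mu (v ++ [a]))))
    (fun a => (INR q * ln (t v) - ln (mu v)) * mu (v ++ [a]) - mu (v ++ [a]) * ln (t (v ++ [a])))).
  - rewrite lsum_minus, lsum_scal, mu_children; ring.
  - intros a _; destruct (mu_cases (v ++ [a])) as [[H P] | [_ ->]]; [|lra].
    destruct (Pref_app m Omega hS _ _ H) as [Hv _].
    rewrite mu_app at 2; rewrite ln_mult, ln_pr by auto using mu_pos, pr_pos; ring.
Qed.

Definition dentropy (k : nat) : R := entropy (S k) - entropy k.

Lemma dentropy_bound k : Rabs (dentropy k) <= INR q * lt_max.
Proof.
  unfold dentropy; rewrite entropy_S; pose proof (mean_ln_t_bounds k); pose proof (mean_ln_t_bounds (S k)).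
  pose proof (INR_q_ge2 q hq); apply Rabs_le; nra.
Qed.

Lemma dentropy_cv :
  Un_cv (fun L => (1 - / INR q) * lsum (seq 0 L) (fun l => dentropy l / INR q ^ l))
        ((INR q - 1) * ln (t [])).
Proof.
  pose proof (INR_q_ge2 q hq) as Hq.
  (* By [entropy_S] the summand is a difference of consecutive values of
     [mean_ln_t l / q ^ (l - 1)], so only the value at the root and a remainder of order [q ^ (-L)]
     survive. *)
  assert (E : forall L, (1 - / INR q) * lsum (seq 0 L) (fun l => dentropy l / INR q ^ l) =
              (INR q - 1) * ln (t []) - (INR q - 1) * mean_ln_t L / INR q ^ L).
  { induction L as [|L IH].
    - simpl; rewrite lsum_nil, mean_ln_t_0; field; lra.
    - rewrite lsum_seq_S, Rmult_plus_distr_l, IH; simpl (0 + L)%nat; unfold dentropy; rewrite entropy_S; simpl.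
      field; split; [apply pow_nonzero|]; lra. }
  intros eps He.
  destruct (inv_pow_small q hq ((INR q - 1) * lt_max) eps He) as [L0 H]; exists L0; intros L HL.
  specialize (H L HL); rewrite E; unfold Rdist.
  replace (_ - _) with (- ((INR q - 1) * mean_ln_t L / INR q ^ L)) by ring.
  assert (P : 0 < / INR q ^ L) by (apply Rinv_0_lt_compat, pow_lt; lra).
  pose proof (mean_ln_t_bounds L). rewrite Rabs_Ropp, Rabs_pos_eq.
  - eapply Rle_lt_trans; [|apply H]. apply Rmult_le_compat_r; [lra|]. apply Rmult_le_compat_l; lra.
  - apply Rmult_le_pos; [apply Rmult_le_pos; lra | lra].
Qed.

(* The mass that the product measure on [X_Omega] gives to the cylinder of
   the first [n] coordinates of [x]. *)
Definition mass (n : nat) (x : sequence) : R :=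
  lprod (seq 1 n) (fun p => pr (chain q (base q p) (val q p) x) (x (p - 1)%nat)).

Lemma mass_chains n N x : (n <= N)%nat ->
  mass n x = lprod (bases q N) (fun i => mu (chain q i (cnt q i n) x)).
Proof.
  intros Hn; symmetry.
  rewrite (lprod_bases q hq (fun i k => mu (chain q i k x))
            (fun i k => pr (chain q i k x) (x (i * q ^ k - 1)%nat)) n N Hn).
  - apply lprod_ext; intros p Hp; apply in_seq in Hp; do 2 f_equal.
    destruct (base_val_spec q hq p) as (D & _); lia.
  - reflexivity.
  - intros i k; rewrite chain_S; apply mu_app.
Qed.

Lemma mass_agree n x y : agree n x y -> mass n x = mass n y.
Proof.
  intros A; rewrite !(mass_chains n n) by lia; apply lprod_ext; intros i Hi.
  apply in_bases in Hi as [H1 H2]; rewrite (chain_agree q hq i n x y); auto; lia.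
Qed.

Lemma mass_nonneg n x : 0 <= mass n x.
Proof. apply lprod_nonneg; intros; apply pr_nonneg. Qed.

Lemma mass_S n x :
  mass (S n) x = mass n x * pr (chain q (base q (S n)) (val q (S n)) x) (x n).
Proof. unfold mass; rewrite lprod_seq_S; simpl (1 + n - 1)%nat; now rewrite Nat.sub_0_r. Qed.

Lemma mass_children n u : length u = n ->
  lsum (seq 0 m) (fun a => mass (S n) (toseq (u ++ [a]))) = mass n (toseq u).
Proof.
  intros Hu.
  set (v := chain q (base q (S n)) (val q (S n)) (toseq u)).
  destruct (base_val_spec q hq (S n)) as (D & H1 & H2); [lia|].
  rewrite (lsum_ext _ _ _ (fun a => mass n (toseq u) * pr v a)).
  (* The transition probabilities sum to 1 only at prefixes; where the mass is nonzero, the chain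
     word [v] is one. *)
  - rewrite lsum_scal; destruct (Req_dec (mass n (toseq u)) 0) as [-> | N]; [lra|].
    rewrite pr_sum; [lra|]. apply mu_neq0.
    (* The list of bases extends to [S n] because [S n] may itself start a chain. *)
    rewrite (mass_chains n (S n)) in N by lia.
    unfold v; rewrite <- cnt_base by auto.
    apply (lprod_neq0 _ _ _ N (base q (S n))), base_in_bases; auto; lia.
  - intros a _; rewrite mass_S.
    assert (A : agree n (toseq (u ++ [a])) (toseq u)) by (rewrite <- Hu; apply toseq_app).
    rewrite (mass_agree n _ _ A); f_equal.
    replace (toseq (u ++ [a]) n) with a by (rewrite <- Hu; now rewrite toseq_app_last).
    f_equal; unfold v.
    rewrite <- cnt_base by auto; apply chain_agree; auto.
Qed.

(** Consistency of the masses; with it, events that concern different lengths are compared at one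
    deep level. *)
Lemma mass_marginal (n K : nat) (G : sequence -> R) : (n <= K)%nat ->
  (forall x y, agree n x y -> G x = G y) ->
  lsum (words m K) (fun u => mass K (toseq u) * G (toseq u)) =
  lsum (words m n) (fun u => mass n (toseq u) * G (toseq u)).
Proof.
  intros HK HG; induction HK as [|K HK IH]; auto.
  rewrite lsum_words_S, <- IH; apply lsum_ext; intros u Hu; apply words_length in Hu.
  rewrite <- (mass_children K u Hu), Rmult_comm, <- lsum_scal; apply lsum_ext; intros a _.
  rewrite (HG (toseq (u ++ [a])) (toseq u)); [ring|].
  apply agree_le with (length u); [lia | apply toseq_app].
Qed.

Lemma mass_total n : lsum (words m n) (fun u => mass n (toseq u)) = 1.
Proof.
  pose proof (mass_marginal 0 n (fun _ => 1) ltac:(lia) (fun _ _ _ => eq_refl)) as H.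
  rewrite (lsum_ext _ _ _ (fun u => mass n (toseq u) * 1)) by (intros; ring).
  rewrite H; cbn [words]; rewrite lsum_cons, lsum_nil; unfold mass; simpl; rewrite lprod_nil; ring.
Qed.

Lemma mass_neq0_extend n u : length u = n -> mass n (toseq u) <> 0 ->
  exists x, X_Omega m q Omega x /\ starts_with x u.
Proof.
  intros Hu H; apply X_Omega_extend with n; auto; intros i Hi Hi'.
  apply mu_neq0; rewrite (mass_chains n n) in H by lia.
  apply (lprod_neq0 _ _ _ H i), in_bases; auto.
Qed.

(** * The upper bound for the Hausdorff dimension *)

Lemma ln_lprod A (l : list A) f : (forall a, In a l -> 0 < f a) ->
  ln (lprod l f) = lsum l (fun a => ln (f a)).
Proof.
  induction l as [|a l IH]; intros H; [apply ln_1|].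
  rewrite lprod_cons, lsum_cons, ln_mult, IH; auto.
  - intros; apply H; now right.
  - apply H; now left.
  - apply lprod_pos; intros; apply H; now right.
Qed.

Definition dimc : R := (INR q - 1) * ln (t []).

Definition sum_ln_t (x : sequence) (n : nat) : R :=
  lsum (seq 1 n) (fun p => ln (t (chain q (base q p) (S (val q p)) x))).

Lemma X_Omega_chain_Pref x p k : X_Omega m q Omega x -> (1 <= p)%nat ->
  Pref Omega (chain q (base q p) k x).
Proof.
  intros Hx Hp; destruct (base_val_spec q hq p Hp) as (_ & H1 & H2).
  apply X_Omega_Pref with m; auto.
Qed.

Lemma chain_position x p : (1 <= p)%nat ->
  chain q (base q p) (S (val q p)) x = chain q (base q p) (val q p) x ++ [x (p - 1)%nat].
Proof.
  intros Hp; rewrite chain_S; do 3 f_equal.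
  destruct (base_val_spec q hq p Hp) as (D & _); lia.
Qed.

Lemma mass_pos x n : X_Omega m q Omega x -> 0 < mass n x.
Proof.
  intros Hx; apply lprod_pos; intros p Hp; apply in_seq in Hp; apply pr_pos.
  rewrite <- chain_position by lia; apply X_Omega_chain_Pref; auto; lia.
Qed.

(** By [ln_pr], position [p] contributes [ln t] at the word ending at [p] and [- q] times [ln t] at
    the word before it. For [p = q * p'] the latter word ends at [p'], which produces the sum up to
    [n / q]; every other [p] starts a chain and contributes the root. *)
Lemma ln_mass x n : X_Omega m q Omega x ->
  ln (mass n x) = sum_ln_t x n
    - INR q * (ln (t []) * (INR n - INR (n / q)) + sum_ln_t x (n / q)).
Proof.
  intros Hx; unfold mass; rewrite ln_lprod.
  - rewrite (lsum_ext _ _ _ (fun p => ln (t (chain q (base q p) (S (val q p)) x))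
               - INR q * ln (t (chain q (base q p) (val q p) x)))).
    + rewrite lsum_minus, lsum_scal; unfold sum_ln_t; do 2 f_equal.
      apply (lsum_by_multiples q hq (fun p => ln (t (chain q (base q p) (val q p) x)))).
      * intros p Hp; now rewrite val_0.
      * intros p Hp; now rewrite val_mul, base_mul.
    + intros p Hp; apply in_seq in Hp; rewrite chain_position by lia; apply ln_pr.
      rewrite <- chain_position by lia; apply X_Omega_chain_Pref; auto; lia.
  - intros p Hp; apply in_seq in Hp; apply pr_pos.
    rewrite <- chain_position by lia; apply X_Omega_chain_Pref; auto; lia.
Qed.

(* Along [n = q ^ j] the normalised logarithms of the masses telescope up to
   a bounded error, so they cannot all exceed the mean. *)
Lemma mass_large x eta n0 : X_Omega m q Omega x -> 0 < eta ->
  exists n, (n0 <= n)%nat /\ exp (- (dimc + eta) * INR n) <= mass n x.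
Proof.
  intros Hx He; apply NNPP; intros N.
  pose proof (INR_q_ge2 q hq) as Hq.
  set (a := fun j => sum_ln_t x (q ^ j) / INR q ^ j).
  assert (a0 : forall j, 0 <= a j).
  { intros j; apply Rmult_le_pos; [|apply Rlt_le, Rinv_0_lt_compat, pow_lt; lra].
    apply lsum_nonneg; intros p Hp; apply in_seq in Hp; apply ln_t_bounds.
    apply X_Omega_chain_Pref; auto; lia. }
  (* With all masses small, [ln_mass] at [n = q ^ (j + 1)], where [n / q = q ^ j], makes the
     normalised sums [a] drop by [eta] at each step, although they are nonnegative. *)
  assert (step : forall j, (n0 <= j)%nat -> a (S j) <= a j - eta).
  { intros j Hj.
    assert (Hb : (n0 <= q ^ S j)%nat) by (pose proof (Nat.pow_gt_lin_r q (S j)); lia).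
    assert (M : mass (q ^ S j) x < exp (- (dimc + eta) * INR (q ^ S j))).
    { apply Rnot_le_lt; intros H; apply N; exists (q ^ S j)%nat; auto. }
    apply ln_increasing in M; [|now apply mass_pos].
    rewrite ln_exp, ln_mass in M by auto.
    replace (q ^ S j / q)%nat with (q ^ j)%nat in M
      by (simpl; rewrite Nat.mul_comm, Nat.div_mul; lia).
    rewrite !pow_INR in M; unfold a, dimc in *; simpl (INR q ^ S j) in *.
    assert (P : 0 < INR q ^ j) by (apply pow_lt; lra).
    set (Q := INR q ^ j) in *; set (S1 := sum_ln_t x (q ^ S j)) in *; set (S0 := sum_ln_t x (q ^ j)) in *.
    apply Rmult_le_reg_r with (INR q * Q); [nra|].
    replace (S1 / (INR q * Q) * (INR q * Q)) with S1 by (field; lra).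
    replace ((S0 / Q - eta) * (INR q * Q)) with (INR q * S0 - eta * (INR q * Q)) by (field; lra).
    nra. }
  assert (dec_a : forall k, a (n0 + k)%nat <= a n0 - INR k * eta).
  { induction k as [|k IH]; [rewrite Nat.add_0_r; simpl; lra|].
    rewrite Nat.add_succ_r, S_INR; pose proof (step (n0 + k)%nat (Nat.le_add_r n0 k)); lra. }
  destruct (INR_unbounded (a n0 / eta)) as [k Hk].
  specialize (dec_a k); specialize (a0 (n0 + k)%nat).
  apply (Rmult_lt_compat_r eta) in Hk; auto.
  replace (a n0 / eta * eta) with (a n0) in Hk by (field; lra). lra.
Qed.

Lemma powd_nonneg d s : 0 <= powd d s.
Proof. unfold powd; destruct (Rle_dec d 0); [lra | apply Rlt_le, exp_pos]. Qed.

Lemma powd_le d s p : 0 < s -> d <= / INR m ^ p -> powd d s <= exp (- (s * ln (INR m)) * INR p).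
Proof.
  intros Hs Hd; unfold powd; destruct (Rle_dec d 0) as [|H]; [apply Rlt_le, exp_pos|].
  apply Rle_trans with (Rpower (/ INR m ^ p) s).
  - apply Rle_Rpower_l; lra.
  - unfold Rpower; rewrite m_pow_exp, ln_exp by auto. apply Req_le; f_equal; ring.
Qed.

Context (hC : closed_in_Sigma m Omega).

Lemma X_compact (C : nat -> sset) :
  (forall n x, C n x -> exists k, forall y, agree k x y -> C n y) ->
  (forall x, X_Omega m q Omega x -> exists n, C n x) ->
  exists M, forall x, X_Omega m q Omega x -> exists n, (n <= M)%nat /\ C n x.
Proof.
  intros Hopen Hcov; apply compactness with m; auto; [now intros x [] |].
  apply X_Omega_seq_closed; auto. now apply closed_in_Sigma_seq_closed with m.
Qed.

(** Here [s * ln m = dimc + 2 * eta], so a cylinder of length [n] with mass at least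
    [exp (- (dimc + eta) n)] costs at most [exp (- eta n)] times its mass, and those of one length
    cost at most [exp (- eta n)] together. By [mass_large] they cover [X_Omega]. *)
Lemma Hzero_above s : 0 < s -> dimc < s * ln (INR m) -> Hzero m s (X_Omega m q Omega).
Proof.
  intros Hs Hd delta eps Hdelta Heps.
  set (eta := (s * ln (INR m) - dimc) / 2). assert (He : 0 < eta) by (unfold eta; lra).
  assert (H1 : 0 < 1 - exp (- eta)).
  { assert (exp (- eta) < 1) by (rewrite <- exp_0; apply exp_increasing; lra). lra. }
  destruct (exp_small eta (eps * (1 - exp (- eta)))) as [n1 Hn1]; auto; [nra|].
  destruct (exists_pow_small m hm delta Hdelta) as [n2 Hn2].
  set (n0 := Nat.max n1 n2).
  set (big := fun n x => exp (- (dimc + eta) * INR n) <= mass n x).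
  destruct (X_compact (fun n x => (n0 <= n)%nat /\ big n x)) as [M HM].
  { intros n x [Hn Hb]; exists n; intros y Hy; split; auto; unfold big.
    now rewrite <- (mass_agree n x y). }
  { intros x Hx; apply mass_large; auto. }
  set (L := flat_map (fun n => filter (fun u => dec (big n (toseq u))) (words m n)) (seq n0 (S M))).
  assert (HL : forall u, In u L -> (n0 <= length u)%nat).
  { intros u Hu; apply in_flat_map in Hu as (n & Hn & Hu); apply filter_In in Hu as [Hu _].
    apply words_length in Hu; apply in_seq in Hn; lia. }
  (* Beyond the finite list the sets are empty; their diameter is at most 0 and [powd] charges
     nothing for them. *)
  set (U := fun k x => (k < length L)%nat /\ inSigma m x /\ starts_with x (nth k L [])).
  assert (HD : forall k, (k < length L)%nat -> diam m (U k) <= / INR m ^ length (nth k L [])).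
  { intros k Hk; apply diam_cylinder; auto.
    intros x y (_ & _ & Hx) (_ & _ & Hy). eapply agree_trans; [apply Hx | apply agree_sym, Hy]. }
  assert (HD0 : forall k, (length L <= k)%nat -> diam m (U k) <= 0).
  { intros k Hk; apply diam_le; [lra|]; intros x y (H & _); lia. }
  exists U; split; [|split; [|split]].
  - now intros n x (_ & H & _).
  - intros k; destruct (le_lt_dec (length L) k) as [Hk | Hk]; [specialize (HD0 k Hk); lra|].
    eapply Rle_trans; [apply HD; auto|]. eapply Rle_trans; [|apply Hn2].
    apply inv_pow_le_iff; auto. specialize (HL _ (nth_In L [] Hk)); lia.
  - intros x Hx; destruct (HM x Hx) as (n & Hn & Hn0 & Hb).
    assert (Hin : In (map x (seq 0 n)) L).
    { apply in_flat_map; exists n; split; [apply in_seq; lia|].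
      apply filter_In; split; [apply prefix_in_words, Hx|]. apply dec_true; unfold big.
      now rewrite (mass_agree n _ x (toseq_prefix n x)). }
    destruct (In_nth L _ [] Hin) as (k & Hk & E); exists k; split; auto; split; [apply Hx|].
    rewrite E; apply starts_with_prefix.
  - exists (lsum (seq 0 (length L)) (fun k => powd (diam m (U k)) s)); split.
    + apply infinite_sum_finite; intros k Hk; unfold powd; specialize (HD0 k Hk).
      destruct (Rle_dec (diam m (U k)) 0); tauto.
    + apply Rle_lt_trans with (lsum (seq n0 (S M)) (fun n => exp (- eta * INR n))).
      * apply Rle_trans with (lsum L (fun u => exp (- (s * ln (INR m)) * INR (length u)))).
        -- rewrite <- (lsum_nth _ L []); apply lsum_le; intros k Hk; apply in_seq in Hk.
           apply powd_le; auto; apply HD; lia.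
        -- unfold L; rewrite lsum_flat_map; apply lsum_le; intros n _.
           rewrite lsum_filter, <- (Rmult_1_r (exp (- eta * INR n))), <- (mass_total n), <- lsum_scal.
           apply lsum_le; intros u Hu; apply words_length in Hu; rewrite Hu.
           destruct (classic (big n (toseq u))) as [B | B].
           ++ rewrite ind_true, Rmult_1_l by auto.
              apply Rle_trans with (exp (- eta * INR n) * exp (- (dimc + eta) * INR n)).
              ** rewrite <- exp_plus; apply Req_le; f_equal; unfold eta; field.
              ** apply Rmult_le_compat_l; [apply Rlt_le, exp_pos | apply B].
           ++ rewrite ind_false, Rmult_0_l by auto.
              apply Rmult_le_pos; [apply Rlt_le, exp_pos | apply mass_nonneg].
      * eapply Rle_lt_trans; [apply geometric_tail; auto|].
        apply Rmult_lt_reg_r with (1 - exp (- eta)); auto.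
        unfold Rdiv; rewrite Rmult_assoc, Rinv_l, Rmult_1_r by lra. apply Hn1; lia.
Qed.

(** * The lower bound for the Hausdorff dimension *)

Lemma exp_neg_bound y : 0 <= y -> exp (- y) <= 1 - y + y ^ 2.
Proof.
  intros Hy; rewrite exp_Ropp; pose proof (exp_ineq1_le y).
  apply Rle_trans with (/ (1 + y)); [apply Rinv_le_contravar; lra|].
  apply Rmult_le_reg_l with (1 + y); [lra|]. rewrite Rinv_r by lra.
  replace ((1 + y) * (1 - y + y ^ 2)) with (1 + y ^ 3) by ring.
  pose proof (pow_le y 3 Hy); lra.
Qed.

Let C0 : R := INR q * lt_max.

(** With [y = - ln (mu v)] in [[0, k * C0]] the factor [Rpower (mu v) lam] is [exp (- lam y)]. The
    bound [1 - lam y + (lam y)^2] for it has mean at most [1 + z], and [1 + z <= exp z] gives a form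
    that multiplies well over chains. *)
Lemma moment_bound (lam : R) k : 0 <= lam ->
  lsum (words m k) (fun v => mu v * Rpower (mu v) lam)
  <= exp (- lam * entropy k + (lam * C0) ^ 2 * INR k ^ 2).
Proof.
  intros Hl; set (z := - lam * entropy k + (lam * C0) ^ 2 * INR k ^ 2).
  pose proof (exp_ineq1_le z).
  apply Rle_trans with (1 + z); [|lra]. unfold z, entropy.
  rewrite <- (mu_total k) at 1.
  apply Rle_trans with (lsum (words m k) (fun v =>
     (mu v + - lam * - (mu v * ln (mu v))) + ((lam * C0) ^ 2 * INR k ^ 2) * mu v)).
  - apply lsum_le; intros v Hv; apply words_length in Hv.
    destruct (mu_cases v) as [[H0 P] | [_ ->]]; [|lra].
    pose proof (ln_mu_bounds v H0) as [B1 B2]; rewrite Hv in B2; fold C0 in B2.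
    unfold Rpower; set (y := - ln (mu v)) in *.
    replace (lam * ln (mu v)) with (- (lam * y)) by (unfold y; ring).
    assert (Hy : 0 <= lam * y) by nra.
    pose proof (exp_neg_bound (lam * y) Hy) as E.
    assert (Q : (lam * y) ^ 2 <= (lam * C0) ^ 2 * INR k ^ 2).
    { replace ((lam * C0) ^ 2 * INR k ^ 2) with ((lam * (INR k * C0)) ^ 2) by ring.
      apply pow_incr; split; auto. apply Rmult_le_compat_l; auto. }
    replace (ln (mu v)) with (- y) by (unfold y; ring).
    apply Rle_trans with (mu v * (1 - lam * y + (lam * C0) ^ 2 * INR k ^ 2)).
    + apply Rmult_le_compat_l; lra.
    + apply Req_le; ring.
  - rewrite !lsum_plus, !lsum_scal, mu_total; apply Req_le; ring.
Qed.

(** [Rpower] takes a positive value at the base 0, where its multiplicativity can fail; the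
    prefactor restores it. *)
Lemma lprod_Rpower A (l : list A) f lam : (forall a, 0 <= f a) ->
  lprod l f * Rpower (lprod l f) lam = lprod l (fun a => f a * Rpower (f a) lam).
Proof.
  intros H; induction l as [|a l IH].
  - rewrite !lprod_nil; unfold Rpower; rewrite ln_1, Rmult_0_r, exp_0; ring.
  - rewrite !lprod_cons, <- IH.
    assert (P : 0 <= lprod l f) by (apply lprod_nonneg; auto).
    destruct (Req_dec (f a) 0) as [-> | N]; [ring|].
    destruct (Req_dec (lprod l f) 0) as [-> | N']; [ring|].
    specialize (H a). rewrite <- Rpower_mult_distr by lra; ring.
Qed.

Lemma mass_moment (lam : R) n : 0 <= lam ->
  lsum (words m n) (fun u => mass n (toseq u) * Rpower (mass n (toseq u)) lam)
  <= exp (- lam * lsum (seq 1 n) (fun p => dentropy (val q p)) + 3 * (lam * C0) ^ 2 * INR n).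
Proof.
  intros Hl; pose (g := fun (_ : nat) v => mu v * Rpower (mu v) lam).
  rewrite (lsum_ext _ _ _ (fun u => lprod (bases q n) (fun i => g i (chain q i (cnt q i n) (toseq u))))).
  2:{ intros u _; rewrite (mass_chains n n) by lia. apply lprod_Rpower; intros; apply mu_nonneg. }
  rewrite chain_sum by lia.
  set (f := fun k => - lam * entropy k + (lam * C0) ^ 2 * INR k ^ 2).
  apply Rle_trans with (lprod (bases q n) (fun i => exp (f (cnt q i n)))).
  { apply lprod_le; intros i _; split; [|now apply moment_bound].
    apply lsum_nonneg; intros v _; apply Rmult_le_pos; [apply mu_nonneg | apply Rlt_le, exp_pos]. }
  rewrite (lprod_bases q hq (fun _ k => exp (f k)) (fun _ k => exp (f (S k) - f k))); auto.
  - rewrite lprod_exp.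
    (* Since [(k + 1)^2 - k^2 = 2 k + 1], the quadratic errors of the chains become [2 * val p + 1]
       per position, at most [3 * n] in total. *)
    assert (E : lsum (seq 1 n) (fun p => f (S (val q p)) - f (val q p)) =
       - lam * lsum (seq 1 n) (fun p => dentropy (val q p)) +
       (lam * C0) ^ 2 * (2 * lsum (seq 1 n) (fun p => INR (val q p)) + INR n)).
    { replace (INR n) with (lsum (seq 1 n) (fun _ => 1)) by (rewrite lsum_const, length_seq; ring).
      rewrite <- lsum_scal, <- (lsum_scal _ _ 2), <- lsum_plus, <- lsum_scal, <- lsum_plus.
      apply lsum_ext; intros p _; unfold f, dentropy; rewrite S_INR; ring. }
    rewrite E; pose proof (lsum_val_le q hq n) as V.
    pose proof (pow2_ge_0 (lam * C0)).
    set (z1 := lsum _ (fun p => INR (val q p))) in *.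
    assert (Z : (lam * C0) ^ 2 * (2 * z1 + INR n) <= 3 * (lam * C0) ^ 2 * INR n) by nra.
    destruct (Rle_lt_or_eq_dec _ _ Z) as [Z' | ->]; [|apply Req_le; reflexivity].
    apply Rlt_le, exp_increasing; lra.
  - intros _; unfold f; rewrite entropy_0; simpl; rewrite <- exp_0; f_equal; ring.
  - intros _ k; rewrite <- exp_plus; f_equal; ring.
Qed.

(** Markov's inequality for the power [lam] of the mass: where the mass exceeds [exp (- s1 n)], the
    factor [exp (lam s1 n) * mass ^ lam] is at least 1. Its mean is small because the mean of
    [- ln mass] is about [dimc * n], with [dimc > s1]. *)
Lemma chernoff s1 : s1 < dimc -> exists c n0, 0 < c /\ forall n, (n0 <= n)%nat ->
  lsum (words m n) (fun u => mass n (toseq u) * ind (exp (- s1 * INR n) < mass n (toseq u)))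
  <= exp (- c * INR n).
Proof.
  intros Hs; set (eta := dimc - s1). assert (He : 0 < eta) by (unfold eta; lra).
  assert (HC0 : 0 < C0).
  { apply Rmult_lt_0_compat; [pose proof (INR_q_ge2 q hq); lra | now apply lt_max_pos]. }
  (* chosen so that [3 * (lam * C0) ^ 2 = lam * eta / 4] *)
  set (lam := eta / (12 * C0 ^ 2)).
  assert (Hl : 0 < lam) by (apply Rdiv_lt_0_compat; auto; pose proof (pow_lt C0 2 HC0); lra).
  destruct (lsum_val_asymptotics q hq _ _ dentropy dentropy_bound dentropy_cv (eta / 4)) as [n0 Hn0]; [lra|].
  fold dimc in Hn0.
  exists (lam * (eta / 4)), n0; split; [apply Rmult_lt_0_compat; lra|]; intros n Hn.
  specialize (Hn0 n Hn); apply Rabs_le_bounds in Hn0.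
  apply Rle_trans with (exp (lam * s1 * INR n) *
     lsum (words m n) (fun u => mass n (toseq u) * Rpower (mass n (toseq u)) lam)).
  - rewrite <- lsum_scal; apply lsum_le; intros u _; set (w := mass n (toseq u)).
    assert (Hw : 0 <= w) by apply mass_nonneg.
    destruct (classic (exp (- s1 * INR n) < w)) as [B | B].
    + rewrite ind_true, Rmult_1_r by auto; unfold Rpower.
      rewrite (Rmult_comm w), <- Rmult_assoc, <- exp_plus.
      apply Rle_trans with (1 * w); [lra|]. apply Rmult_le_compat_r; auto.
      pose proof (exp_ineq1_le (lam * s1 * INR n + lam * ln w)).
      assert (L : - s1 * INR n <= ln w).
      { rewrite <- (ln_exp (- s1 * INR n)); apply ln_mono; [apply exp_pos | lra]. }
      assert (0 <= lam * s1 * INR n + lam * ln w) by nra. lra.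
    + rewrite ind_false, Rmult_0_r by auto.
      apply Rmult_le_pos; [|apply Rmult_le_pos; auto]; apply Rlt_le, exp_pos.
  - eapply Rle_trans; [apply Rmult_le_compat_l; [apply Rlt_le, exp_pos | apply mass_moment; lra]|].
    rewrite <- exp_plus.
    set (A := lsum _ _) in *.
    assert (E3 : 3 * (lam * C0) ^ 2 = lam * (eta / 4)) by (unfold lam; field; lra).
    rewrite E3.
    (* Of the gain [lam * eta * n], one quarter is lost to the average of [dentropy] and one to the
       second-order term. *)
    assert (Z : lam * s1 * INR n + (- lam * A + lam * (eta / 4) * INR n) <= - (lam * (eta / 4)) * INR n).
    { replace s1 with (dimc - eta) by (unfold eta; ring).
      pose proof (pos_INR n).
      assert (lam * (INR n * dimc - A) <= lam * (eta / 4 * INR n)) by (apply Rmult_le_compat_l; lra).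
      assert (0 <= lam * eta * INR n) by (apply Rmult_le_pos; [nra | auto]). lra. }
    destruct (Rle_lt_or_eq_dec _ _ Z) as [Z' | ->]; [apply Rlt_le, exp_increasing; auto | lra].
Qed.

(** Replacing a set by a cylinder containing it loses at most the factor [m ^ s] in cost. A set of
    diameter 0 costs nothing, while every cylinder costs something; [eps] pays for a sufficiently
    long one. *)
Lemma cylinder_for_set (U : sset) s N eps :
  0 < s -> 0 < eps -> diam m U <= / INR m ^ N ->
  exists p, (N <= p)%nat /\ diam m U <= / INR m ^ p /\
    exp (- (s * ln (INR m)) * INR p) <= exp (s * ln (INR m)) * powd (diam m U) s + eps.
Proof.
  intros Hs He HD; pose proof (ln_m_pos m hm) as Lm.
  destruct (Rle_lt_dec (diam m U) 0) as [Z | P].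
  - destruct (exp_small (s * ln (INR m)) eps) as [p Hp]; [nra | auto |].
    exists (Nat.max N p); split; [lia|]; split.
    + pose proof (inv_pow_pos m hm (Nat.max N p)); lra.
    + specialize (Hp (Nat.max N p) ltac:(lia)). pose proof (powd_nonneg (diam m U) s).
      pose proof (exp_pos (s * ln (INR m))). nra.
  - destruct (dec_inh_nat_subset_has_unique_least_element (fun n => / INR m ^ n < diam m U)) as (n & [Hn Hm] & _).
    { intros; apply classic. }
    { destruct (exists_pow_small m hm (diam m U / 2)) as [p Hp]; [lra|]. exists p; lra. }
    assert (Nn : (N < n)%nat).
    { apply Nat.nle_gt; intros H; apply (inv_pow_le_iff m hm) in H; lra. }
    exists (n - 1)%nat; split; [lia|]; split.
    + apply Rnot_lt_le; intros H; apply Hm in H; lia.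
    + unfold powd; destruct (Rle_dec (diam m U) 0); [lra|].
      assert (E : Rpower (/ INR m ^ n) s <= Rpower (diam m U) s).
      { apply Rle_Rpower_l; [lra | split; [now apply inv_pow_pos | lra]]. }
      apply Rle_trans with (exp (s * ln (INR m)) * Rpower (/ INR m ^ n) s).
      * unfold Rpower at 1; rewrite m_pow_exp, ln_exp, <- exp_plus, minus_INR by (auto; lia).
        apply Req_le; f_equal; simpl; ring.
      * pose proof (exp_pos (s * ln (INR m))). nra.
Qed.

Lemma half_pow_sum M : lsum (seq 0 M) (fun n => (/ 2) ^ S n) <= 1.
Proof.
  assert (E : lsum (seq 0 M) (fun n => (/ 2) ^ S n) = 1 - (/ 2) ^ M).
  { induction M as [|M IH]; [simpl; rewrite lsum_nil; lra|].
    rewrite lsum_seq_S, IH; simpl; lra. }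
  rewrite E; pose proof (pow_lt (/ 2) M ltac:(lra)); lra.
Qed.

(** The total mass 1 at a common level [K] is split by the covering cylinder of each word: either
    its mass is at most its cost, or it is a cylinder of too large mass and length at least [N]. The
    first kind carries at most 1/2 in total, the second at most 1/4. *)
Lemma Hzero_not_below s : 0 < s -> Hzero m s (X_Omega m q Omega) -> dimc <= s * ln (INR m).
Proof.
  intros Hs HZ; apply Rnot_lt_le; intros Hd.
  destruct (chernoff _ Hd) as (c & n1 & Hc & Hch).
  set (s1 := s * ln (INR m)) in *.
  assert (H1 : 0 < 1 - exp (- c)).
  { assert (exp (- c) < 1) by (rewrite <- exp_0; apply exp_increasing; lra). lra. }
  destruct (exp_small c (1 / 4 * (1 - exp (- c)))) as [n2 Hn2]; auto; [lra|].
  set (N := Nat.max n1 n2).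
  (* The factor [exp s1] of [cylinder_for_set] turns the cost of the cover into at most 1/4; the
     weights [/ 4 * (/ 2) ^ S n] below add at most another 1/4. *)
  destruct (HZ (/ INR m ^ N) (exp (- s1) / 4)) as (U & HU1 & HU2 & HU3 & l & Hl & Hlt).
  { now apply inv_pow_pos. }
  { pose proof (exp_pos (- s1)); lra. }
  assert (Hp : forall n, exists p, (N <= p)%nat /\ diam m (U n) <= / INR m ^ p /\
     exp (- s1 * INR p) <= exp s1 * powd (diam m (U n)) s + / 4 * (/ 2) ^ S n).
  { intros n; apply cylinder_for_set with (N := N); auto.
    pose proof (pow_lt (/ 2) (S n) ltac:(lra)); lra. }
  apply fun_choice in Hp as [p Hp].
  assert (Hy : forall n, exists y, (exists z, U n z) -> U n y).
  { intros n; destruct (classic (exists z, U n z)) as [[z Hz] | Nz].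
    - exists z; auto.
    - exists (fun _ => O); tauto. }
  apply fun_choice in Hy as [y Hy].
  destruct (X_compact (fun n x => agree (p n) (y n) x)) as [M HM].
  { intros n x Hx; exists (p n); intros z Hz; eapply agree_trans; eauto. }
  { intros x Hx; destruct (HU3 x Hx) as [n Hn]; exists n.
    apply (dist_le_iff m hm); eapply Rle_trans; [|apply Hp].
    apply dist_le_diam; auto. apply Hy; eauto. }
  set (K := list_max (map p (seq 0 (S M)))).
  assert (HK : forall n, (n <= M)%nat -> (p n <= K)%nat).
  { intros n Hn; pose proof (proj1 (list_max_le (map p (seq 0 (S M))) _) (le_n _)) as F.
    rewrite Forall_forall in F; apply F, in_map, in_seq; lia. }
  set (good := fun n (x : sequence) => agree (p n) (y n) x /\ mass (p n) x <= exp (- s1 * INR (p n))).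
  set (bad := fun k (x : sequence) => exp (- s1 * INR k) < mass k x).
  assert (B1 : lsum (words m K) (fun u => mass K (toseq u)) <=
     lsum (words m K) (fun u => lsum (seq 0 (S M)) (fun n => mass K (toseq u) * ind (good n (toseq u))) +
                                lsum (seq N (S K - N)) (fun k => mass K (toseq u) * ind (bad k (toseq u))))).
  { apply lsum_le; intros u Hu; apply words_length in Hu.
    rewrite !lsum_scal, <- Rmult_plus_distr_l.
    pose proof (mass_nonneg K (toseq u)) as W0.
    destruct (Req_dec (mass K (toseq u)) 0) as [-> | Nz]; [lra|].
    rewrite <- (Rmult_1_r (mass K (toseq u))) at 1; apply Rmult_le_compat_l; auto.
    (* A word of nonzero mass extends to a point of [X_Omega], which the finite cover catches; the
       catching cylinder has length at most [K], so it contains the word as well. *)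
    destruct (mass_neq0_extend K u Hu Nz) as (x & Hx & Hsx).
    destruct (HM x Hx) as (n & Hn & Ha).
    assert (Hau : agree (p n) (y n) (toseq u)).
    { eapply agree_trans; [apply Ha|]. apply agree_le with K; auto. rewrite <- Hu; apply Hsx. }
    assert (P1 : 0 <= lsum (seq 0 (S M)) (fun n => ind (good n (toseq u)))).
    { apply lsum_nonneg; intros; apply ind_bounds. }
    assert (P2 : 0 <= lsum (seq N (S K - N)) (fun k => ind (bad k (toseq u)))).
    { apply lsum_nonneg; intros; apply ind_bounds. }
    destruct (Rle_lt_dec (mass (p n) (toseq u)) (exp (- s1 * INR (p n)))) as [G | G].
    - assert (E : ind (good n (toseq u)) <= lsum (seq 0 (S M)) (fun n => ind (good n (toseq u)))).
      { apply (lsum_ge_term _ _ (fun n => ind (good n (toseq u)))).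
        - intros; apply ind_bounds.
        - apply in_seq; lia. }
      rewrite ind_true in E by (split; auto). lra.
    - assert (E : ind (bad (p n) (toseq u)) <= lsum (seq N (S K - N)) (fun k => ind (bad k (toseq u)))).
      { apply (lsum_ge_term _ _ (fun k => ind (bad k (toseq u)))).
        - intros; apply ind_bounds.
        - apply in_seq; destruct (Hp n) as [Hp1 _]; specialize (HK n Hn); lia. }
      rewrite ind_true in E by auto. lra. }
  rewrite mass_total, lsum_plus, !(lsum_exchange _ _ (words m K)) in B1.
  assert (B2 : lsum (seq 0 (S M)) (fun n => lsum (words m K) (fun u => mass K (toseq u) * ind (good n (toseq u))))
               <= 1 / 2).
  { apply Rle_trans with (lsum (seq 0 (S M)) (fun n => exp s1 * powd (diam m (U n)) s + / 4 * (/ 2) ^ S n)).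
    - apply lsum_le; intros n Hn; apply in_seq in Hn.
      eapply Rle_trans; [|apply Hp].
      rewrite (mass_marginal (p n) K (fun x => ind (good n x))).
      (* At length [p n] only one word agrees with [y n], and being good bounds its mass by the cost
         of the cylinder. *)
      + apply Rle_trans with (lsum (words m (p n)) (fun u =>
           exp (- s1 * INR (p n)) * ind (agree (p n) (y n) (toseq u)))).
        * apply lsum_le; intros u _; destruct (classic (good n (toseq u))) as [G | G].
          -- rewrite !ind_true by (auto; apply G). destruct G; lra.
          -- rewrite (ind_false (good n (toseq u))), Rmult_0_r by auto.
             apply Rmult_le_pos; [apply Rlt_le, exp_pos | apply ind_bounds].
        * rewrite lsum_scal.
          rewrite <- (Rmult_1_r (exp (- s1 * INR (p n)))) at 2.
          apply Rmult_le_compat_l; [apply Rlt_le, exp_pos|].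
          apply lsum_ind_unique; [apply words_NoDup|].
          intros u v Hu Hv A1 A2; apply words_length in Hu, Hv.
          apply list_eq_toseq; [lia|]. rewrite Hu; eapply agree_trans; [apply agree_sym, A1 | auto].
      + apply HK; lia.
      + intros x z A; apply ind_iff; unfold good. rewrite (mass_agree (p n) x z A).
        assert (agree (p n) (y n) x <-> agree (p n) (y n) z); [|tauto].
        split; intros A'; eapply agree_trans; eauto using agree_sym.
    - rewrite lsum_plus, !lsum_scal.
      pose proof (half_pow_sum (S M)) as Hh.
      assert (Hs0 : lsum (seq 0 (S M)) (fun n => powd (diam m (U n)) s) <= l).
      { rewrite <- sum_f_R0_lsum; apply sum_incr; auto. intros; apply powd_nonneg. }
      assert (exp s1 * lsum (seq 0 (S M)) (fun n => powd (diam m (U n)) s) <= exp s1 * (exp (- s1) / 4)).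
      { apply Rmult_le_compat_l; [apply Rlt_le, exp_pos | lra]. }
      replace (exp s1 * (exp (- s1) / 4)) with (/ 4) in H.
      + lra.
      + rewrite exp_Ropp; field. apply Rgt_not_eq, exp_pos. }
  assert (B3 : lsum (seq N (S K - N)) (fun k => lsum (words m K) (fun u => mass K (toseq u) * ind (bad k (toseq u))))
               <= 1 / 4).
  { apply Rle_trans with (lsum (seq N (S K - N)) (fun k => exp (- c * INR k))).
    - apply lsum_le; intros k Hk; apply in_seq in Hk.
      rewrite (mass_marginal k K (fun x => ind (bad k x))); [apply Hch; lia | lia |].
      intros x z A; apply ind_iff; unfold bad; rewrite (mass_agree k x z A); tauto.
    - eapply Rle_trans; [apply geometric_tail; auto|].
      apply Rmult_le_reg_r with (1 - exp (- c)); auto.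
      unfold Rdiv at 1; rewrite Rmult_assoc, Rinv_l, Rmult_1_r by lra.
      apply Rlt_le, Hn2; lia. }
  lra.
Qed.

Lemma dimH_value : is_dimH m (X_Omega m q Omega) ((INR q - 1) * logm m (t [])).
Proof.
  pose proof (ln_m_pos m hm) as Lm. pose proof (INR_q_ge2 q hq) as Hq.
  replace ((INR q - 1) * logm m (t [])) with (dimc / ln (INR m)) by (unfold dimc, logm; field; lra).
  assert (Hd : 0 <= dimc).
  { apply Rmult_le_pos; [lra|]. apply ln_t_bounds, Pref_nil; auto. }
  split.
  - intros s [Hs HZ]; apply Hzero_not_below in HZ; auto.
    apply Rmult_le_reg_r with (ln (INR m)); auto. unfold Rdiv; rewrite Rmult_assoc, Rinv_l; lra.
  - intros b Hb; apply Rnot_lt_le; intros H.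
    (* An [s] strictly between the dimension and [b] contradicts [b] being a lower bound; it is
       positive since the dimension is nonnegative. *)
    set (s := (b + dimc / ln (INR m)) / 2).
    assert (D0 : 0 <= dimc / ln (INR m)) by (apply Rmult_le_pos; [auto | apply Rlt_le, Rinv_0_lt_compat; auto]).
    assert (Hbs : b <= s); [|unfold s in Hbs; lra].
    apply Hb; split; [unfold s; lra|]. apply Hzero_above; [unfold s; lra|].
    apply Rmult_lt_reg_r with (/ ln (INR m)); [now apply Rinv_0_lt_compat|].
    rewrite Rmult_assoc, Rinv_r, Rmult_1_r by lra. change (dimc / ln (INR m) < s); unfold s; lra.
Qed.

(** * Equality of the two dimensions *)

Lemma ln_ge_1_minus_inv y : 0 < y -> 1 - / y <= ln y.
Proof.
  intros Hy; pose proof (exp_ineq1_le (- ln y)) as H.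
  rewrite exp_Ropp, exp_ln in H by auto; lra.
Qed.

Lemma ln_eq_1_minus_inv y : 0 < y -> ln y = 1 - / y -> y = 1.
Proof.
  intros Hy E; destruct (Req_dec (ln y) 0) as [Z | N].
  - rewrite <- (exp_ln y), Z, exp_0 by auto; auto.
  - assert (N' : - ln y <> 0) by lra.
    pose proof (exp_ineq1 _ N') as H; rewrite exp_Ropp, exp_ln in H by auto; lra.
Qed.

Notation N_ k := (INR (card_Pref_k m Omega k)).

Definition gap (k : nat) : R := ln_card m Omega k - entropy k.

(* A relative entropy, written so that every summand is nonnegative. *)
Lemma gap_sum k : gap k = lsum (words m k) (fun v =>
  ind (Pref Omega v) * (mu v * ln (mu v * N_ k) - mu v + / N_ k)).
Proof.
  pose proof (card_Pref_ge1 m Omega hS hne k) as H1.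
  (* The corrections [- mu v] and [/ N_ k] sum to -1 and 1 and cancel; they make each summand
     nonnegative by [1 - / y <= ln y]. *)
  rewrite (lsum_ext _ _ _ (fun v => (mu v * ln (N_ k) - - (mu v * ln (mu v))) - mu v
             + / N_ k * ind (Pref Omega v))).
  - rewrite lsum_plus, !lsum_minus, lsum_scal, <- card_Pref_ind, Rinv_l by lra.
    rewrite (lsum_ext _ _ (fun v => mu v * ln (N_ k)) (fun v => ln (N_ k) * mu v)) by (intros; ring).
    rewrite lsum_scal, mu_total; unfold gap, entropy, ln_card; ring.
  - intros v _; destruct (mu_cases v) as [[H P] | [H ->]].
    + rewrite ind_true, ln_mult by (auto; lra); ring.
    + rewrite ind_false by auto; ring.
Qed.

Lemma gap_term_nonneg k v :
  0 <= ind (Pref Omega v) * (mu v * ln (mu v * N_ k) - mu v + / N_ k).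
Proof.
  pose proof (card_Pref_ge1 m Omega hS hne k) as H1.
  destruct (mu_cases v) as [[H P] | [H E]]; [|rewrite ind_false by auto; lra].
  rewrite ind_true, Rmult_1_l by auto.
  assert (Q : 0 < mu v * N_ k) by nra.
  pose proof (ln_ge_1_minus_inv _ Q) as L.
  apply (Rmult_le_compat_l (mu v)) in L; [|lra].
  replace (mu v * (1 - / (mu v * N_ k))) with (mu v - / N_ k) in L by (field; lra). lra.
Qed.

Lemma gap_nonneg k : 0 <= gap k.
Proof. rewrite gap_sum; apply lsum_nonneg; intros; apply gap_term_nonneg. Qed.

Lemma gap_0 : gap 0 = 0.
Proof. unfold gap; rewrite ln_card_0, entropy_0; auto; lra. Qed.

(** All summands of [gap_sum] vanish, and equality in [1 - / y <= ln y] forces [y = mu v * N_ k] to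
    be 1. *)
Lemma gap_zero_uniform k v : gap k = 0 -> length v = k -> Pref Omega v -> mu v = / N_ k.
Proof.
  intros G L H; rewrite gap_sum in G.
  pose proof (card_Pref_ge1 m Omega hS hne k) as H1; pose proof (mu_pos v H) as P.
  assert (Hin : In v (words m k)) by (rewrite <- L; apply Pref_in_words with Omega; auto).
  pose proof (lsum_nonneg_eq0 _ _ _ (fun v _ => gap_term_nonneg k v) G v Hin) as Z; cbn beta in Z.
  rewrite ind_true, Rmult_1_l in Z by auto.
  assert (E : mu v * N_ k = 1).
  { apply ln_eq_1_minus_inv; [nra|].
    apply Rmult_eq_reg_l with (mu v); [|lra].
    replace (mu v * (1 - / (mu v * N_ k))) with (mu v - / N_ k) by (field; lra). lra. }
  apply Rmult_eq_reg_r with (N_ k); [|lra]. rewrite E, Rinv_l; lra.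
Qed.

(** In the limit, summation by parts exhibits the difference of the two dimensions, up to the factor
    [ln m], as a series with nonnegative terms. *)
Lemma gap_partial L :
  dln_card_partial m q Omega L - (1 - / INR q) * lsum (seq 0 L) (fun l => dentropy l / INR q ^ l) =
  (INR q - 1) ^ 2 * lsum (seq 0 L) (fun k => gap (S k) / INR q ^ (S k + 1))
  + (1 - / INR q) * (gap L / INR q ^ L).
Proof.
  pose proof (INR_q_ge2 q hq).
  rewrite <- (abel_summation _ gap) by (lra || apply gap_0).
  unfold dln_card_partial; rewrite <- Rmult_minus_distr_l, <- lsum_minus; f_equal.
  apply lsum_ext; intros l _; unfold dln_card, dentropy, gap; field; apply pow_nonzero; lra.
Qed.

(** A single positive [gap] keeps all later differences away from 0, which survives the limit. *)
Lemma gap_partial_ge k L : (k < L)%nat ->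
  (INR q - 1) ^ 2 * (gap (S k) / INR q ^ (S k + 1)) <=
  dln_card_partial m q Omega L - (1 - / INR q) * lsum (seq 0 L) (fun l => dentropy l / INR q ^ l).
Proof.
  intros Hk; pose proof (INR_q_ge2 q hq) as Hq; rewrite gap_partial.
  assert (P : forall j n, 0 <= gap j / INR q ^ n).
  { intros j n; apply Rmult_le_pos; [apply gap_nonneg | apply Rlt_le, Rinv_0_lt_compat, pow_lt; lra]. }
  assert (I1 : / INR q <= 1) by (rewrite <- Rinv_1; apply Rinv_le_contravar; lra).
  assert (T : 0 <= (1 - / INR q) * (gap L / INR q ^ L)) by (apply Rmult_le_pos; [lra | apply P]).
  assert (S1 : gap (S k) / INR q ^ (S k + 1) <= lsum (seq 0 L) (fun k => gap (S k) / INR q ^ (S k + 1))).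
  { apply (lsum_ge_term _ _ (fun k => gap (S k) / INR q ^ (S k + 1))).
    - intros; apply P.
    - apply in_seq; lia. }
  assert (0 <= (INR q - 1) ^ 2) by apply pow2_ge_0. nra.
Qed.

Context (I0 : R) (hI : Un_cv (dln_card_partial m q Omega) I0).

Lemma gap_partial_cv :
  Un_cv (fun L => dln_card_partial m q Omega L
                  - (1 - / INR q) * lsum (seq 0 L) (fun l => dentropy l / INR q ^ l)) (I0 - dimc).
Proof. apply CV_minus; [exact hI | apply dentropy_cv]. Qed.

Lemma dims_ordered : dimc <= I0.
Proof.
  pose proof (INR_q_ge2 q hq) as Hq.
  enough (0 <= I0 - dimc) by lra.
  apply Rle_cv_lim with (fun _ => 0) (fun L => dln_card_partial m q Omega (S L)
                  - (1 - / INR q) * lsum (seq 0 (S L)) (fun l => dentropy l / INR q ^ l)).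
  - intros L; eapply Rle_trans; [|apply (gap_partial_ge 0); lia].
    apply Rmult_le_pos; [apply pow2_ge_0|].
    apply Rmult_le_pos; [apply gap_nonneg | apply Rlt_le, Rinv_0_lt_compat, pow_lt; lra].
  - apply Un_cv_const.
  - apply Un_cv_shift with (f := fun L => dln_card_partial m q Omega L
                  - (1 - / INR q) * lsum (seq 0 L) (fun l => dentropy l / INR q ^ l)).
    apply gap_partial_cv.
Qed.

Lemma gap_zero_of_dims_eq k : dimc = I0 -> gap k = 0.
Proof.
  intros E; destruct k as [|k]; [apply gap_0|].
  pose proof (INR_q_ge2 q hq) as Hq; pose proof (gap_nonneg (S k)) as G.
  destruct (Req_dec (gap (S k)) 0) as [|N]; auto; exfalso.
  set (tau := (INR q - 1) ^ 2 * (gap (S k) / INR q ^ (S k + 1))).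
  assert (Ht : 0 < tau).
  { apply Rmult_lt_0_compat; [apply pow_lt; lra|]. apply Rdiv_lt_0_compat; [lra | apply pow_lt; lra]. }
  destruct (gap_partial_cv tau Ht) as [L0 HL].
  specialize (HL (Nat.max L0 (S k)) (Nat.le_max_l _ _)).
  pose proof (gap_partial_ge k (Nat.max L0 (S k)) ltac:(lia)) as H; fold tau in H.
  unfold Rdist in HL; set (z := dln_card_partial _ _ _ _ - _) in *.
  rewrite E, Rminus_diag, Rminus_0_r in HL; pose proof (Rle_abs z); lra.
Qed.

(** Uniformity on two consecutive levels: the mass [/ N_ k] of [u] is shared by its children, of
    mass [/ N_ (S k)] each, so their number depends on the level only. *)
Lemma symmetric_of_dims_eq : dimc = I0 -> spherically_symmetric m Omega.
Proof.
  intros E.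
  assert (H : forall k u, Pref_k Omega k u -> INR (nchild m Omega u) = N_ (S k) / N_ k).
  { intros k u Hu; pose proof (proj1 Hu) as L; apply Pref_k_length in Hu; auto.
    pose proof (card_Pref_ge1 m Omega hS hne k); pose proof (card_Pref_ge1 m Omega hS hne (S k)).
    pose proof (gap_zero_uniform k u (gap_zero_of_dims_eq k E) L Hu) as M.
    rewrite <- mu_children in M.
    rewrite (lsum_ext _ _ _ (fun j => / N_ (S k) * ind (Pref Omega (u ++ [j])))), lsum_scal, <- nchild_ind in M.
    - apply Rmult_eq_reg_l with (/ N_ (S k)); [rewrite M; field; lra|].
      apply Rinv_neq_0_compat; lra.
    - intros j _; destruct (classic (Pref Omega (u ++ [j]))) as [Hj | Hj].
      + rewrite ind_true, Rmult_1_r by auto.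
        apply gap_zero_uniform; auto using gap_zero_of_dims_eq. rewrite length_app; simpl; lia.
      + rewrite ind_false by auto. destruct (mu_cases (u ++ [j])) as [[] | [_ ->]]; [tauto | lra]. }
  intros k u v _ Hu Hv; apply INR_eq; rewrite (H k u), (H k v); auto.
Qed.

Lemma dln_card_symmetric u : spherically_symmetric m Omega -> Pref Omega u ->
  dln_card m Omega (length u) = ln (INR (nchild m Omega u)).
Proof.
  intros HS Hu; set (k := length u).
  pose proof (card_Pref_ge1 m Omega hS hne k) as H1; pose proof (nchild_ge1 m Omega hS u Hu) as H2.
  assert (E : N_ (S k) = INR (nchild m Omega u) * N_ k).
  { rewrite card_Pref_S, card_Pref_ind, <- lsum_scal by auto; apply lsum_ext; intros v Hv.
    apply words_length in Hv.
    destruct (classic (Pref Omega v)) as [P | P]; [|rewrite ind_false by auto; ring].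
    replace (nchild m Omega v) with (nchild m Omega u); [ring|].
    (* Symmetry is demanded from level 1 on; level 0 has the root as its only word. *)
    destruct (Nat.eq_dec k 0) as [Z | Z].
    - rewrite Z in Hv; apply length_zero_iff_nil in Z, Hv; now subst.
    - apply (HS k); [lia | auto | rewrite <- Hv; auto]. }
  unfold dln_card, ln_card; rewrite E, ln_mult; lra.
Qed.

(** The equation for [t] is unfolded along [n] levels, on each of which all vertices branch alike,
    and [ln t >= 0] ends the recursion. A lower bound is enough, since [dims_ordered] supplies the
    opposite inequality for the dimensions. *)
Lemma ln_t_symmetric n : spherically_symmetric m Omega -> forall u, Pref Omega u ->
  lsum (seq 0 n) (fun l => dln_card m Omega (length u + l) / INR q ^ S l) <= ln (t u).
Proof.
  intros HS; pose proof (INR_q_ge2 q hq) as Hq.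
  induction n as [|n IH]; intros u Hu; [simpl; rewrite lsum_nil; now apply ln_t_bounds|].
  rewrite <- cons_seq, lsum_cons, lsum_seq_shift, Nat.add_0_r, dln_card_symmetric by auto.
  set (B := lsum (seq 0 n) (fun l => dln_card m Omega (S (length u) + l) / INR q ^ S l)).
  replace (lsum (seq 0 n) _) with (/ INR q * B).
  2:{ unfold B; rewrite <- lsum_scal; apply lsum_ext; intros l _.
      rewrite Nat.add_succ_r; simpl; field; split; [apply pow_nonzero|]; lra. }
  pose proof (nchild_ge1 m Omega hS u Hu) as H2.
  destruct (ht u Hu) as [[H1 _] E].
  assert (C : INR (nchild m Omega u) * exp B <= t u ^ q).
  { rewrite E, nchild_ind, Rmult_comm, <- lsum_scal.
    apply lsum_le; intros j _; unfold ind; destruct (dec _) eqn:D; [|lra].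
    apply (proj1 (dec_iff _)) in D; specialize (IH _ D).
    rewrite length_app, Nat.add_1_r in IH; fold B in IH.
    pose proof (t_ge1 _ D). rewrite Rmult_1_r, <- (exp_ln (t (u ++ [j]))) by lra.
    destruct IH as [IH | ->]; [apply Rlt_le, exp_increasing; auto | lra]. }
  apply ln_mono in C; [|pose proof (exp_pos B); nra].
  rewrite ln_mult, ln_exp, ln_pow in C by (lra || apply exp_pos).
  apply Rmult_le_reg_l with (INR q); [lra|].
  simpl; rewrite Rmult_1_r; replace (INR q * _) with (ln (INR (nchild m Omega u)) + B) by (field; lra).
  lra.
Qed.

Lemma dims_eq_of_symmetric : spherically_symmetric m Omega -> dimc = I0.
Proof.
  intros HS; pose proof (INR_q_ge2 q hq) as Hq; apply Rle_antisym; [apply dims_ordered|].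
  apply Rle_cv_lim with (dln_card_partial m q Omega) (fun _ => dimc); auto using Un_cv_const.
  intros n; pose proof (ln_t_symmetric n HS [] (Pref_nil Omega hne)) as H; simpl length in H.
  unfold dln_card_partial, dimc.
  replace (lsum (seq 0 n) (fun l => dln_card m Omega l / INR q ^ l)) with
    (INR q * lsum (seq 0 n) (fun l => dln_card m Omega (0 + l) / INR q ^ S l)).
  - replace (INR q - 1) with ((1 - / INR q) * INR q) by (field; lra).
    rewrite Rmult_assoc; apply Rmult_le_compat_l; [|apply Rmult_le_compat_l; lra].
    assert (/ INR q <= 1) by (rewrite <- Rinv_1; apply Rinv_le_contravar; lra). lra.
  - rewrite <- lsum_scal; apply lsum_ext; intros l _; simpl; field; split; [apply pow_nonzero|]; lra.
Qed.

End Measure.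

(** * Uniqueness of the Hausdorff dimension and comparison of both dimensions *)

Lemma is_glb_unique P d1 d2 : is_glb P d1 -> is_glb P d2 -> d1 = d2.
Proof. intros [A1 B1] [A2 B2]; apply Rle_antisym; auto. Qed.

Theorem theorem2p2 (m q : nat) (Omega : sset) :
  (2 <= m)%nat -> (2 <= q)%nat ->
  (forall x, Omega x -> inSigma m x) ->
  (exists x, Omega x) ->
  closed_in_Sigma m Omega ->
  (exists t, tvec m q Omega t) /\
  (forall t, tvec m q Omega t ->
     is_dimH m (X_Omega m q Omega) ((INR q - 1) * logm m (t nil))) /\
  (exists l,
     infinite_sum
       (fun k => logm m (INR (card_Pref_k m Omega (S k))) / INR q ^ (S k + 1)) l /\
     is_dimM m (X_Omega m q Omega) ((INR q - 1) ^ 2 * l)) /\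
  (forall dH dM, is_dimH m (X_Omega m q Omega) dH ->
     is_dimM m (X_Omega m q Omega) dM ->
     (dH = dM <-> spherically_symmetric m Omega)).
Proof.
  intros hm hq hS hne hC.
  assert (HH : forall t, tvec m q Omega t ->
     is_dimH m (X_Omega m q Omega) ((INR q - 1) * logm m (t nil))) by (intros; now apply dimH_value).
  destruct (card_series m q Omega hm hq hS hne) as (l & Hl & Hcv).
  assert (HM : is_dimM m (X_Omega m q Omega) ((INR q - 1) ^ 2 * l)) by now apply dimM_value.
  destruct (tvec_exists m q Omega hm hq hS) as [t Ht].
  split; [now exists t|]; split; [exact HH|]; split; [now exists l|].
  intros dH dM H1 H2.
  (* [dH] and [dM] are any values meeting the definitions; uniqueness replaces them by the computed
     ones for one fixed [t]. *)
  rewrite (is_glb_unique _ _ _ H1 (HH t Ht)).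
  rewrite (dimM_unique m q Omega _ _ H2 HM).
  pose proof (ln_m_pos m hm) as Lm.
  assert (E : (INR q - 1) * logm m (t []) = (INR q - 1) ^ 2 * l <->
              dimc q t = (INR q - 1) ^ 2 * l * ln (INR m)).
  { unfold dimc, logm; split; intros H.
    - rewrite <- H; field; lra.
    - apply Rmult_eq_reg_r with (ln (INR m)); [|lra]. rewrite <- H; field; lra. }
  rewrite E; split; intros H.
  - now apply (symmetric_of_dims_eq m q Omega t hm hq hS hne Ht _ Hcv).
  - now apply (dims_eq_of_symmetric m q Omega t hm hq hS hne Ht _ Hcv).
Qed.
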